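(* There exists a function $f:\mathbb{N}\to\mathbb{N}$ such that for every $n\geq 1$, every hypergraph $H$ of degree 2 with $\mathrm{ghw}(H) > f(n)$ dilutes to the $n\times n$-jigsaw.
   Context: A hypergraph $H$ is a pair $(V(H),E(H))$ with $E(H)\subseteq 2^{V(H)}$ a set. For a vertex $v$, $I_v$ is the set of edges containing $v$; the degree of $H$ is $\max_v|I_v|$. The dual $H^d$ has $V(H^d)=E(H)$ and $E(H^d)=\{I_v: v\in V(H)\}$. The $n\times m$-jigsaw is (up to isomorphism) the dual $G^d$ of the $n\times m$ grid graph $G$; thus its edges correspond to grid vertices and its vertices to grid edges, each vertex lying in exactly the two edges corresponding to the endpoints of that grid edge. $\mathrm{ghw}(H)$ is the minimum over tree decompositions $(T,(B_u))$ of $H$ (every edge inside some bag; for each vertex the bags containing it form a connected subtree) of $\max_u\rho_H(B_u)$, where $\rho_H(B)$ is the minimum number of edges of $H$ covering $B$. $H'$ dilutes to $H$ if $H$ is isomorphic to a hypergraph reachable from $H'$ by a finite sequence of: deleting a vertex (from the vertex set and all edges); deleting an edge that is a proper subset of another edge; merging on a vertex $v$, i.e., replacing all edges of $I_v$ by the single edge $(\bigcup I_v)\setminus\{v\}$. *)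

(* Defs.v *)
From Stdlib Require Relation_Operators.
From mathcomp Require Import all_boot.
Set Implicit Arguments. Unset Strict Implicit. Unset Printing Implicit Defensive.

Record hypergraph (T : finType) := Hyp { hV : {set T}; hE : {set {set T}} }.

Definition wf_hyp (T : finType) (H : hypergraph T) : Prop :=
  forall e, e \in hE H -> e \subset hV H.

Definition inc (T : finType) (H : hypergraph T) (v : T) : {set {set T}} :=
  [set e in hE H | v \in e].

Definition degree (T : finType) (H : hypergraph T) : nat :=
  \max_(v in hV H) #|inc H v|.

Definition dual (T : finType) (H : hypergraph T) : hypergraph {set T} :=
  Hyp (hE H) [set inc H v | v in hV H].

Definition is_tree (U : finType) (r : rel U) : Prop :=
  [/\ symmetric r, irreflexive r, inhabited U,
      (forall x y, connect r x y) &
      ~ (exists (x : U) (p : seq U),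
            [&& 2 <= size p, uniq (x :: p), path r x p & r (last x p) x])].

Definition cover_le (T : finType) (H : hypergraph T) (B : {set T}) (k : nat) : Prop :=
  exists S : {set {set T}},
    [/\ S \subset hE H, #|S| <= k & B \subset \bigcup_(e in S) e].

Definition tree_decomposition (T : finType) (H : hypergraph T)
  (U : finType) (r : rel U) (B : U -> {set T}) : Prop :=
  [/\ is_tree r,
      (forall e, e \in hE H -> exists u, e \subset B u) &
      (forall v, v \in hV H -> forall u1 u2, v \in B u1 -> v \in B u2 ->
          connect [rel a b | [&& r a b, v \in B a & v \in B b]] u1 u2)].

Definition ghw_le (T : finType) (H : hypergraph T) (k : nat) : Prop :=
  exists (U : finType) (r : rel U) (B : U -> {set T}),
    tree_decomposition H r B /\ forall u, cover_le H (B u) k.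

Definition del_vertex (T : finType) (H : hypergraph T) (v : T) : hypergraph T :=
  Hyp (hV H :\ v) [set e :\ v | e in hE H].

Definition del_edge (T : finType) (H : hypergraph T) (e : {set T}) : hypergraph T :=
  Hyp (hV H) (hE H :\ e).

Definition merge (T : finType) (H : hypergraph T) (v : T) : hypergraph T :=
  Hyp (hV H) ((hE H :\: inc H v) :|: [set (\bigcup_(e in inc H v) e) :\ v]).

Inductive dil_step (T : finType) (H : hypergraph T) : hypergraph T -> Prop :=
| DS_vertex v : v \in hV H -> dil_step H (del_vertex H v)
| DS_edge e e' : e \in hE H -> e' \in hE H -> e \proper e' -> dil_step H (del_edge H e)
| DS_merge v : v \in hV H -> dil_step H (merge H v).

Definition hyp_iso (T1 T2 : finType) (H1 : hypergraph T1) (H2 : hypergraph T2) : Prop :=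
  exists f : T1 -> T2,
    [/\ {in hV H1 &, injective f}, f @: hV H1 = hV H2 &
        [set f @: (e : {set T1}) | e in hE H1] = hE H2].

Definition dilutes (T1 T2 : finType) (H' : hypergraph T1) (H : hypergraph T2) : Prop :=
  exists H0 : hypergraph T1,
    Relation_Operators.clos_refl_trans (hypergraph T1) (@dil_step T1) H' H0 /\ hyp_iso H0 H.

Definition grid_adj (n : nat) : rel (prod 'I_n 'I_n) :=
  fun x y =>
    let: (i, j) := x in let: (i', j') := y in
    ((i == i' :> nat) && ((j.+1 == j') || (j'.+1 == j)))
    || ((j == j' :> nat) && ((i.+1 == i') || (i'.+1 == i))).

Definition grid (n : nat) : hypergraph (prod 'I_n 'I_n) :=
  Hyp [set: prod 'I_n 'I_n] [set [set x; y] | x in [set: prod 'I_n 'I_n], y in [set z | grid_adj x z]].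

Definition jigsaw (n : nat) : hypergraph {set (prod 'I_n 'I_n)} := dual (grid n).

(* Main.v *)
Require Import Defs.
From Stdlib Require Import Classical ClassicalEpsilon Relation_Operators.
From mathcomp Require Import all_boot zify.

Set Implicit Arguments.
Unset Strict Implicit.
Unset Printing Implicit Defensive.

(** Let [G] be the graph on the edges of [H] in which two edges are adjacent when
    they meet. A tree decomposition of [G] with bags of size at most [w] gives one
    of [H] in which every bag is covered by [w] edges, so large ghw forces large
    tree-width of [G], and then [G] has a grid minor. Since every vertex of [H]
    lies in at most two edges, merging on the vertices inside the branch sets,
    keeping one vertex for each edge of the grid and deleting all the others turns
    [H] into the jigsaw.

    The excluded grid theorem is proved as follows. If no small set separates some
    [W] in a balanced way, the connected sets containing more than half of [W] form
    a bramble of large order. A path meeting all its members is cut into many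
    segments, any two of which are joined by a large linkage. The key step concerns
    a linkage of [l] paths and a much larger family of disjoint connected sets: if
    many of these sets meet [k] of the paths and the linkage uses as few edges
    outside the sets as possible, then the sets cross the paths in a linear order,
    which yields a grid. Otherwise some of the sets meet few paths, can be removed,
    and iterating this produces pairwise disjoint connections between segments,
    that is, a large complete minor. *)

(** The constants are not circular because of the order of quantifiers in [crossing]: the threshold
    [k] depends on [r] alone, while the number [N0] of tolerated sets may depend on the size [l] of
    the linkage. Removing a set that meets fewer than [k] paths costs fewer than [k] paths, however
    many there are; so a linkage of [Lc + k] paths keeps [Lc] of them, and the size of the family is
    chosen afterwards. The value of [k] comes from the shape of a crossing: a set that meets [k]
    paths induces a connected graph on them, and a connected graph with more than [r ^ r] vertices
    contains a path with [r] edges or a star with [r] leaves. The product of either with a long path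
    has a grid minor. On the hypergraph side the obstacle is that edges are sets: they change at
    every dilution step and may coincide afterwards. The dilution is therefore followed through a
    labelling of the original edges. *)

(** * Connected sets, minors and linkages *)

Section Connectivity.
Variables (V : finType) (e : rel V).

(** A relation on all of [V] and not on a subtype: [connect] is reflexive everywhere, so
    [connect (restr X) x x] holds outside [X] too, and membership in [X] has to be carried along
    separately. *)
Definition restr (X : {set V}) : rel V := fun x y => [&& x \in X, y \in X & e x y].
Arguments restr X x y /.

Definition conn (X : {set V}) : Prop :=
  (exists x, x \in X) /\ {in X &, forall x y, connect (restr X) x y}.

Definition adjacent (X Y : {set V}) : Prop :=
  exists x y, [/\ x \in X, y \in Y & e x y].

Lemma restr_sym X : symmetric e -> symmetric (restr X).
Proof. by move=> se x y /=; rewrite se; case: (x \in X); case: (y \in X). Qed.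

Lemma connect_restr_mem (X : {set V}) x y : connect (restr X) x y -> x \in X -> y \in X.
Proof.
case/connectP=> p; elim: p x => [|z p IH] x /=; first by move=> _ ->.
by case/andP=> /and3P[_ zX _] pp lst _; apply: IH pp lst zX.
Qed.

Lemma restr_sub (X Y : {set V}) : X \subset Y -> subrel (connect (restr X)) (connect (restr Y)).
Proof.
move=> /subsetP XY; apply: connect_sub => x y /and3P[xX yX xy]; apply: connect1.
by rewrite /= !XY.
Qed.

Lemma conn1 x : conn [set x].
Proof. by split=> [|u v]; [exists x; rewrite set11 | rewrite !inE => /eqP-> /eqP->]. Qed.

Lemma conn_star (X : {set V}) c : symmetric e -> c \in X ->
  (forall x, x \in X -> connect (restr X) x c) -> conn X.
Proof.
move=> se cX h; split=> [|x y xX yX]; first by exists c.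
apply: connect_trans (h _ xX) _; rewrite sym_connect_sym; last exact: restr_sym.
exact: h.
Qed.

Lemma conn_path (x : V) p : symmetric e -> path e x p -> conn [set y in x :: p].
Proof.
move=> se; elim: p x => [|z p IH] x /=.
  have -> : [set y in [:: x]] = [set x] by apply/setP=> y; rewrite !inE.
  by move=> _; apply: conn1.
case/andP=> xz pp; have [_ cz] := IH _ pp.
have sub : [set y in z :: p] \subset [set y in [:: x, z & p]].
  by apply/subsetP=> y; rewrite !inE => ->; rewrite orbT.
have zx : connect (restr [set y in [:: x, z & p]]) z x.
  by apply: connect1; rewrite /= !inE !eqxx se xz !orbT.
apply: (@conn_star _ x) => //; first by rewrite !inE eqxx.
move=> y; rewrite inE in_cons => /orP[/eqP-> //|yp].
apply: connect_trans zx; apply: (restr_sub sub).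
by apply: cz; rewrite inE // mem_head.
Qed.

Lemma path_restr (X : {set V}) x p : path e x p -> {subset x :: p <= X} -> path (restr X) x p.
Proof.
elim: p x => //= z p IH x /andP[xz pp] sub; rewrite xz !sub ?inE ?eqxx ?orbT //=.
by apply: IH => // y yp; apply: sub; rewrite inE yp orbT.
Qed.

Lemma restr_path_mem (X : {set V}) x p : path (restr X) x p -> {subset p <= X}.
Proof.
elim: p x => //= z p IH x /andP[/and3P[_ zX _] pp] y; rewrite inE => /orP[/eqP->//|].
exact: IH pp _.
Qed.

Lemma restr_pathW (X : {set V}) x p : path (restr X) x p -> path e x p.
Proof. by apply: sub_path => u v /and3P[]. Qed.

End Connectivity.
Arguments restr V e X x y /.

Lemma conn_sub (V : finType) (e e' : rel V) (X : {set V}) :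
  {in X &, subrel e e'} -> conn e X -> conn e' X.
Proof.
move=> ee' [nX cX]; split=> // x y xX yX; apply: connect_sub (cX _ _ xX yX) => u v /and3P[uX vX uv].
by apply: connect1; rewrite /= uX vX ee'.
Qed.

Definition minor (K V : finType) (k : rel K) (e : rel V) : Prop :=
  exists phi : K -> {set V},
    [/\ forall x, conn e (phi x),
        forall x y, x != y -> [disjoint phi x & phi y] &
        forall x y, k x y -> adjacent e (phi x) (phi y)].

Lemma minor_sub (K V : finType) (k : rel K) (e e' : rel V) :
  subrel e e' -> minor k e -> minor k e'.
Proof.
move=> ee' [phi [cphi dphi aphi]]; exists phi; split=> // [x|x y kxy].
  by apply: conn_sub (cphi x) => u v _ _; apply: ee'.
by have [u [v [ux vy uv]]] := aphi _ _ kxy; exists u, v; split=> //; apply: ee'.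
Qed.

Lemma conn_bigcup (K V : finType) (k : rel K) (e : rel V) (phi : K -> {set V}) (X : {set K}) :
  symmetric e -> (forall x, x \in X -> conn e (phi x)) ->
  {in X &, forall x y, k x y -> adjacent e (phi x) (phi y)} ->
  conn k X -> conn e (\bigcup_(x in X) phi x).
Proof.
move=> se cphi aphi [[x0 x0X] cX].
set Y := \bigcup_(x in X) phi x.
have sub x : x \in X -> phi x \subset Y by move=> xX; apply: bigcup_sup.
have [[u0 u0x] _] := cphi _ x0X.
have key x y : x \in X -> connect (restr k X) x y ->
    forall u v, u \in phi x -> v \in phi y -> connect (restr e Y) u v.
  move=> xX /connectP[p]; elim: p x xX => [|z p IH] x xX /=.
    move=> _ -> u v ux vx; apply: (restr_sub (sub _ xX)).
    by have [_] := cphi _ xX; apply.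
  case/andP=> /and3P[_ zX xz] pp lst u v ux vy.
  have [u' [v' [u'x v'z u'v']]] := aphi _ _ xX zX xz.
  have c1 : connect (restr e Y) u u'.
    by apply: (restr_sub (sub _ xX)); have [_] := cphi _ xX; apply.
  apply: connect_trans c1 _; apply: connect_trans (IH _ zX pp lst v' v v'z vy).
  by apply: connect1; rewrite /= (subsetP (sub _ xX)) // (subsetP (sub _ zX)).
split; first by exists u0; apply: (subsetP (sub _ x0X)).
move=> u v /bigcupP[x xX ux] /bigcupP[y yX vy].
by apply: (key x y) => //; apply: cX.
Qed.

Lemma minor_trans (J K V : finType) (j : rel J) (k : rel K) (e : rel V) :
  symmetric e -> minor j k -> minor k e -> minor j e.
Proof.
move=> se [psi [cpsi dpsi apsi]] [phi [cphi dphi aphi]].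
exists (fun x => \bigcup_(y in psi x) phi y); split=> [x|x y xy|x y jxy].
- by apply: (conn_bigcup se _ _ (cpsi x)) => // u v _ _; apply: aphi.
- rewrite -setI_eq0; apply/eqP/setP=> u; rewrite !inE; apply/negP=> /andP[].
  case/bigcupP=> a ax ua /bigcupP[b bx ub].
  have ab : a != b.
    by apply: contraTneq ax => ->; rewrite (disjointFl (dpsi _ _ xy)).
  by rewrite (disjointFr (dphi _ _ ab) ua) in ub.
- have [a [b [ax bY ab]]] := apsi _ _ jxy; have [u [v [ua vb uv]]] := aphi _ _ ab.
  by exists u, v; split=> //; apply/bigcupP; [exists a | exists b].
Qed.

(** The hypothesis of Menger's theorem. The set [S] may use vertices of [A] and [B], and a common
    vertex of [A] and [B] outside [S] counts as a connection. *)
Definition lnk (V : finType) (e : rel V) (A B : {set V}) (L : nat) : Prop :=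
  forall S : {set V}, #|S| < L ->
    exists a b, [/\ a \in A :\: S, b \in B :\: S & connect (restr e (~: S)) a b].

Definition linkage (V : finType) (e : rel V) (A B : {set V}) (L : nat) (P : 'I_L -> seq V) : Prop :=
  [/\ forall i, exists x p, [/\ P i = x :: p, path e x p, x \in A & last x p \in B],
      forall i, uniq (P i) &
      forall i j x, x \in P i -> x \in P j -> i = j].

(** * Menger's theorem *)

Lemma inj_onto (V : finType) k (f : 'I_k -> V) (Z : {set V}) :
  injective f -> (forall i, f i \in Z) -> #|Z| <= k ->
  forall z, z \in Z -> exists i, f i = z.
Proof.
move=> finj fZ cZ z zZ.
have sub : [set f i | i : 'I_k] \subset Z by apply/subsetP=> u /imsetP[i _ ->].
have /eqP E : [set f i | i : 'I_k] == Z.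
  by rewrite eqEcard sub card_imset // card_ord.
by move: zZ; rewrite -E => /imsetP[i _ ->]; exists i.
Qed.

Section Menger.
Variable V : finType.
Implicit Types (e : rel V) (A B S T Z : {set V}).

Lemma linkage_sub e e' A B k (P : 'I_k -> seq V) :
  subrel e e' -> linkage e A B P -> linkage e' A B P.
Proof.
move=> ee' [h1 h2 h3]; split=> // i; have [x [p [-> pp xA lB]]] := h1 i.
by exists x, p; split=> //; apply: sub_path pp.
Qed.

Lemma not_lnkP e A B k : ~ lnk e A B k ->
  exists S, #|S| < k /\ forall a b, a \in A :\: S -> b \in B :\: S ->
    ~~ connect (restr e (~: S)) a b.
Proof.
move=> nl; have [S nS] := not_all_ex_not _ _ nl; have [cS {}nS] := imply_to_and _ _ nS.
exists S; split=> // a b aA bB.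
by apply/negP=> cab; apply: nS; exists a, b.
Qed.

Section RemoveEdge.
Variables (e : rel V) (x y : V).
Let e' : rel V := fun u v => e u v && ((u, v) != (x, y)).

(** Before its first vertex in [Z] a path cannot use the edge from [x] to [y], since [x] lies in
    [Z]. The companion below is the mirror image: after its last vertex in a set containing [y] a
    path cannot use that edge either. *)
Lemma path_first_hit Z T a p : x \in Z -> a \notin T -> path (restr e (~: T)) a p ->
  (exists z, z \in Z :\: T /\ connect (restr e' (~: T)) a z) \/
  (a \notin Z /\ connect (restr e' (~: Z)) a (last a p)).
Proof.
move=> xZ; elim: p a => [|c p IH] a aT /=.
  case: (boolP (a \in Z)) => aZ _; [left; exists a | right]; rewrite ?connect0 ?inE ?aZ ?aT //.
case/andP=> /and3P[_ cT ac] pp; rewrite inE in cT.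
case: (boolP (a \in Z)) => aZ; first by left; exists a; rewrite inE aZ aT connect0.
have ac' : e' a c by rewrite /e' ac /= xpair_eqE negb_and; case: eqP aZ => // ->; rewrite xZ.
case: (IH c cT pp) => [[z [zZ cz]]|[cZ cl]]; [left; exists z | right]; split=> //.
  by apply: connect_trans cz; apply: connect1; rewrite /= !inE aT cT.
by apply: connect_trans cl; apply: connect1; rewrite /= !inE aZ cZ.
Qed.

Lemma path_last_hit Z T a p : y \in Z -> a \notin T -> path (restr e (~: T)) a p ->
  (exists z, z \in Z :\: T /\ connect (restr e' (~: T)) z (last a p)) \/
  (a \notin Z /\ connect (restr e' (~: (T :|: Z))) a (last a p)).
Proof.
move=> yZ; elim: p a => [|c p IH] a aT /=.
  case: (boolP (a \in Z)) => aZ _; [left; exists a | right]; rewrite ?connect0 ?inE ?aZ ?aT //.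
case/andP=> /and3P[_ cT ac] pp; rewrite inE in cT.
case: (IH c cT pp) => [[z [zZ cz]]|[cZ cl]]; first by left; exists z.
have ac' : e' a c.
  by rewrite /e' ac /= xpair_eqE negb_and orbC; case: eqP cZ => // ->; rewrite yZ.
case: (boolP (a \in Z)) => aZ.
  left; exists a; rewrite inE aZ aT; split=> //.
  apply: connect_trans (restr_sub _ cl); first by apply: connect1; rewrite /= !inE aT cT.
  by rewrite setCU subsetIl.
right; split=> //; by apply: connect_trans cl; apply: connect1; rewrite /= !inE !negb_or aZ cZ aT cT.
Qed.

End RemoveEdge.

(* Gluing step: the paths ending in [x |: S] and those starting in [y |: S] can
   only meet in [S], because [S] separates [A] from [B]. *)
Lemma linkage_glue e e' A B S x y k (P Q : 'I_k -> seq V) :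
  subrel e' e -> e x y -> x \notin S -> y \notin S -> #|S|.+1 = k ->
  (forall a b, a \in A :\: S -> b \in B :\: S -> ~~ connect (restr e' (~: S)) a b) ->
  linkage e' A (x |: S) P -> linkage e' (y |: S) B Q ->
  exists R : 'I_k -> seq V, linkage e A B R.
Proof.
move=> e'e exy xS yS cS sep [hP uP dP] [hQ uQ dQ].
have [a /fin_all_exists[p Pp]] := fin_all_exists hP.
have [b /fin_all_exists[q Qq]] := fin_all_exists hQ.
pose lp i := last (a i) (p i).
have lpP i : lp i \in P i by case: (Pp i) => -> _ _ _; apply: mem_last.
have bQ i : b i \in Q i by case: (Qq i) => -> _ _ _; apply: mem_head.
have lpZ i : lp i \in x |: S by case: (Pp i).
have bZ i : b i \in y |: S by case: (Qq i).
have lp_inj : injective lp by move=> i j E; apply: (dP _ _ (lp i)) => //; rewrite E.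
have b_inj : injective b by move=> i j E; apply: (dQ _ _ (b i)) => //; rewrite E.
have lp_onto := inj_onto lp_inj lpZ; have b_onto := inj_onto b_inj bZ.
rewrite !cardsU1 xS yS /= add1n cS leqnn in lp_onto b_onto.
have F1 i v : v \in P i -> v \in x |: S -> v = lp i.
  move=> vP /lp_onto[//|j E]; rewrite -E; congr lp.
  by apply: (dP _ _ v) => //; rewrite -E.
have F2 i v : v \in Q i -> v \in y |: S -> v = b i.
  move=> vP /b_onto[//|j E]; rewrite -E; congr b.
  by apply: (dQ _ _ v) => //; rewrite -E.
have F3 i j v : v \in P i -> v \in Q j -> v \in S.
  move=> vP vQ; apply: contraT => vS.
  have [Pi pp aA lS] := Pp i; have [Qj qq bS lB] := Qq j.
  have := uP i; have := uQ j; have {}F1 := F1 i; have {}F2 := F2 j.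
  rewrite /lp Pi in F1 vP *; rewrite Qj in F2 vQ *.
  case/splitPl: vP pp lS F1 => p1 p2 lp1; rewrite cat_path last_cat lp1.
  case/andP=> pp1 _ lS F1.
  case/splitPl: vQ qq lB F2 => q1 q2 lq1; rewrite cat_path last_cat lq1.
  case/andP=> _ qq2 lB F2.
  move=> uq up.
  have s1 : {subset a i :: p1 <= ~: S}.
    move=> u up1; rewrite inE; apply/negP=> uS.
    have ul : u = last v p2.
      apply: F1; last by rewrite !inE uS orbT.
      by rewrite -cat_cons mem_cat up1.
    case: (lastP p2) ul up => [|p2' w] ul; first by rewrite ul in uS; rewrite uS in vS.
    rewrite last_rcons in ul; rewrite -cat_cons cat_uniq => /and3P[_ /hasPn/(_ u)].
    by rewrite mem_rcons inE ul eqxx -ul up1 => /(_ isT).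
  have s2 : {subset v :: q2 <= ~: S}.
    move=> u; rewrite inE; case: eqP => [->|_] /=; first by rewrite inE vS.
    move=> uq2; rewrite inE; apply/negP=> uS.
    have ub : u = b j.
      apply: F2; last by rewrite !inE uS orbT.
      by rewrite -cat_cons mem_cat uq2 orbT.
    by move: uq; rewrite /= mem_cat -ub uq2 orbT.
  have c1 : connect (restr e' (~: S)) (a i) v.
    by apply/connectP; exists p1; rewrite ?lp1 //; apply: path_restr.
  have c2 : connect (restr e' (~: S)) v (last v q2).
    by apply/connectP; exists q2; rewrite //; apply: path_restr.
  have aS : a i \in A :\: S by rewrite inE aA andbT; have := s1 _ (mem_head _ _); rewrite inE.
  have lBS : last v q2 \in B :\: S.
    by rewrite inE lB andbT; have := s2 _ (mem_last _ _); rewrite inE.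
  by have := sep _ _ aS lBS; rewrite (connect_trans c1 c2).
(* A path ending at [x] crosses the deleted edge and continues with the path starting at [y]. A path
   ending in [S] continues with the path starting at the same vertex, whose head is dropped so that
   it does not occur twice. *)
pose tr z := if z == x then y else z.
have trZ i : tr (lp i) \in y |: S.
  rewrite /tr; case: eqP (lpZ i) => [_ _|ne]; first by rewrite !inE eqxx.
  by rewrite !inE; case: eqP => //= _ ->; rewrite orbT.
have hJ i : exists j, b j = tr (lp i) by apply: b_onto.
have [J JE] := fin_all_exists hJ.
have tr_inj i j : tr (lp i) = tr (lp j) -> i = j.
  rewrite /tr; case: eqP => Ei; case: eqP => Ej E; apply: lp_inj; rewrite ?Ei ?Ej //.
    by have := lpZ j; rewrite !inE -E (negPf yS) orbF => /eqP ->.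
  by have := lpZ i; rewrite !inE E (negPf yS) orbF => /eqP.
pose Qt i := if lp i == x then Q (J i) else behead (Q (J i)).
have QtQ i : {subset Qt i <= Q (J i)}.
  by rewrite /Qt; case: ifP => _ u //; apply: mem_behead.
have PQ i j v : v \in P i -> v \in Q (J j) -> i = j /\ lp i != x.
  move=> vP vQ; have vS := F3 _ _ _ vP vQ.
  have vl : v = lp i by apply: F1; rewrite // !inE vS orbT.
  have vb : v = b (J j) by apply: F2; rewrite // !inE vS orbT.
  have lx : lp i != x by apply: contraNneq xS => <-; rewrite -vl.
  by split=> //; apply: tr_inj; rewrite -[RHS]JE -vb vl /tr (negPf lx).
exists (fun i => P i ++ Qt i); split.
- move=> i; have [Pi pp aA lS] := Pp i; have [Qj qq bS lB] := Qq (J i).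
  exists (a i), (p i ++ Qt i); rewrite Pi; split=> //.
  + rewrite cat_path (sub_path e'e pp) /= -/(lp i) /Qt Qj; have := JE i; rewrite /tr.
    by case: eqP => [->|_] E /=; rewrite ?E ?exy -?E ?(sub_path e'e qq).
  + rewrite last_cat -/(lp i) /Qt Qj; have := JE i; rewrite /tr.
    by case: eqP => [_|_] E //=; rewrite -E.
- move=> i; rewrite cat_uniq uP /=; have [Qj _ _ _] := Qq (J i).
  have -> : uniq (Qt i).
    by rewrite /Qt; case: ifP => // _; have := uQ (J i); rewrite Qj => /andP[].
  rewrite andbT; apply/hasPn=> v vQ; apply/negP=> vP.
  have [_ lx] := PQ _ _ _ vP (QtQ _ _ vQ).
  have vl : v = lp i by apply: F1; rewrite // !inE (F3 _ _ _ vP (QtQ _ _ vQ)) orbT.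
  move: vQ; rewrite /Qt (negPf lx) vl; have := JE i; rewrite /tr (negPf lx) => <-.
  by have := uQ (J i); rewrite Qj /= => /andP[/negP].
- move=> i j v; rewrite !mem_cat => /orP[vi|/QtQ vi] /orP[vj|/QtQ vj].
  + exact: dP vi vj.
  + by have [] := PQ _ _ _ vi vj.
  + by have [] := PQ _ _ _ vj vi.
  + by have E := dQ _ _ _ vi vj; apply: tr_inj; rewrite -!JE E.
Qed.

(** Induction on the number of edges that are not loops. If deleting the edge from [x] to [y]
    destroys the linkedness, some [S] with fewer than [k] vertices separates what remains. Every
    path from [A] to [B] then meets both [x |: S] and [y |: S], reaching the former before it can
    use the edge and leaving the latter after it. Both sets have exactly [k] vertices, and the two
    linkages given by induction are glued. Edges are directed: only the ordered pair is deleted. *)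
Lemma menger e A B k : lnk e A B k -> exists P : 'I_k -> seq V, linkage e A B P.
Proof.
have [n] := ubnP #|[set p : V * V | (p.1 != p.2) && e p.1 p.2]|.
elim: n e A B k => // n IH e A B k le lk.
case: (pickP [pred p : V * V | (p.1 != p.2) && e p.1 p.2]) => [[x y] /= /andP[nxy exy]|none].
  pose e' : rel V := fun u v => e u v && ((u, v) != (x, y)).
  have le' : #|[set p : V * V | (p.1 != p.2) && e' p.1 p.2]| < n.
    rewrite -ltnS; apply: leq_trans le; rewrite ltnS; apply: proper_card; apply/properP; split.
      by apply/subsetP=> p; rewrite !inE /e' => /and3P[-> -> _].
    by exists (x, y); rewrite !inE /e' /= nxy exy ?eqxx.
  have e'e : subrel e' e by move=> u v /andP[].
  case: (classic (lnk e' A B k)) => [/IH[//|P lP]|/not_lnkP[S [cS sep]]].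
    by exists P; apply: linkage_sub lP.
  have sepx T : #|T| < k -> exists a z, [/\ a \in A :\: T, z \in (x |: S) :\: T &
      connect (restr e' (~: T)) a z].
    move=> cT; have [a [b [aA bB /connectP[p pp lst]]]] := lk T cT.
    have aT : a \notin T by move: aA; rewrite inE => /andP[].
    have [[z [zZ cz]]|[aZ cl]] := path_first_hit y (setU11 x S) aT pp; first by exists a, z.
    have [bZ|bZ] := boolP (b \in x |: S).
      have := connect_restr_mem cl; rewrite -lst inE aZ inE bZ; by move/(_ isT).
    move: aZ bZ; rewrite !inE !negb_or => /andP[_ aS] /andP[_ bS].
    have := sep a b; rewrite !inE aS bS /= => /(_ _ _)/negP[].
    - by move: aA; rewrite inE => /andP[].
    - by move: bB; rewrite inE => /andP[].
    by rewrite lst; apply: restr_sub cl; rewrite setCS subsetUr.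
  have sepy T : #|T| < k -> exists z b, [/\ z \in (y |: S) :\: T, b \in B :\: T &
      connect (restr e' (~: T)) z b].
    move=> cT; have [a [b [aA bB /connectP[p pp lst]]]] := lk T cT.
    have aT : a \notin T by move: aA; rewrite inE => /andP[].
    have [[z [zZ cz]]|[aZ cl]] := path_last_hit x (setU11 y S) aT pp.
      by exists z, b; rewrite lst in bB *.
    have [bZ|bZ] := boolP (b \in y |: S).
      have := connect_restr_mem cl; rewrite -lst in_setC in_setU (negPf aT) (negPf aZ).
      by rewrite in_setC in_setU bZ orbT; move/(_ isT).
    move: aZ bZ; rewrite !inE !negb_or => /andP[_ aS] /andP[_ bS].
    have := sep a b; rewrite !inE aS bS /= => /(_ _ _)/negP[].
    - by move: aA; rewrite inE => /andP[].
    - by move: bB; rewrite inE => /andP[].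
    by rewrite lst; apply: restr_sub cl; rewrite setCS setUA subsetUr.
  have big z : (z = x) \/ (z = y) -> k <= #|z |: S|.
    move=> zxy; rewrite leqNgt; apply/negP=> cz.
    case: zxy => E; rewrite {}E in cz.
      by have [a [w [_]]] := sepx _ cz; rewrite setDv inE.
    by have [w [b []]] := sepy _ cz; rewrite setDv inE.
  have := big x (or_introl erefl); have := big y (or_intror erefl).
  rewrite !cardsU1; have [yS|yS] := boolP (y \in S); first by rewrite add0n leqNgt cS.
  have [xS|xS] := boolP (x \in S); first by rewrite add0n [in X in _ -> X]leqNgt cS.
  rewrite !add1n => kS _; have {}cS : #|S|.+1 = k by apply/eqP; rewrite eqn_leq cS kS.
  have [P lP] := IH e' A (x |: S) k le' sepx.
  have [Q lQ] := IH e' (y |: S) B k le' sepy.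
  exact: (linkage_glue e'e exy xS yS cS sep lP lQ).
have loop a b T : connect (restr e T) a b -> a = b.
  case/connectP=> p; elim: p a => //= c p IHp a /andP[/and3P[_ _ ac] pp] /(IHp _ pp) <-.
  by have := none (a, c); rewrite /= ac andbT => /negbFE/eqP.
(* Only loops are left, so [A :&: B] separates [A] from [B] and cannot have fewer than [k]
   vertices. *)
have cAB : k <= #|A :&: B|.
  rewrite leqNgt; apply/negP=> /lk[a [b [aA bB /loop E]]]; rewrite -{}E in bB.
  by move: aA bB; rewrite !inE; case: (a \in A); case: (a \in B).
pose v (i : 'I_k) : V := enum_val (widen_ord cAB i).
exists (fun i => [:: v i]); split=> // [i|i j z].
  by exists (v i), [::]; split=> //=; have := enum_valP (widen_ord cAB i); rewrite inE => /andP[].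
rewrite !inE => /eqP-> /eqP/enum_val_inj/(congr1 val) /= E; exact: val_inj.
Qed.

End Menger.

(** * Cutting a linkage of minimal cost *)

Lemma ex_min (X : Type) (Q : X -> Prop) (f : X -> nat) :
  (exists x, Q x) -> exists x, Q x /\ forall y, Q y -> f x <= f y.
Proof.
case=> x Qx; have [n] := ubnP (f x); elim: n x Qx => // n IH x Qx fx.
case: (classic (exists y, Q y /\ f y < f x)) => [[y [Qy lt]]|no].
  by apply: (IH y Qy); apply: leq_trans lt _; rewrite -ltnS.
by exists x; split=> // y Qy; rewrite leqNgt; apply/negP=> lt; apply: no; exists y.
Qed.

Definition steps (V : eqType) (s : seq V) : seq (V * V) := zip s (behead s).

Lemma path_steps (V : eqType) (r : rel V) x p :
  path r x p = all (fun uv => r uv.1 uv.2) (steps (x :: p)).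
Proof. by elim: p x => //= y p IH x; rewrite IH. Qed.

Lemma mem_steps (V : eqType) (d : V) (s : seq V) t : t.+1 < size s ->
  (nth d s t, nth d s t.+1) \in steps s.
Proof.
move=> lt; have sz : t < size (steps s) by rewrite size_zip size_behead; lia.
have -> : (nth d s t, nth d s t.+1) = nth (d, d) (steps s) t; last exact: mem_nth.
by rewrite nth_zip_cond sz nth_behead.
Qed.

Lemma connect_nth (V : finType) (r : rel V) (d : V) (s : seq V) lo hi : lo <= hi ->
  (forall t, lo <= t < hi -> r (nth d s t) (nth d s t.+1)) ->
  connect r (nth d s lo) (nth d s hi).
Proof.
elim: hi => [|hi IH]; first by rewrite leqn0 => /eqP->.
rewrite leq_eqVlt => /orP[/eqP-> //|lohi] h.
apply: connect_trans (connect1 (h hi _)); last by lia.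
by apply: IH => // t ht; apply: h; lia.
Qed.

Section Cut.
Variables (V : finType) (e : rel V) (I : finType) (M : I -> {set V}).
Hypothesis conM : forall m, conn e (M m).
Variables (A B : {set V}) (l : nat).
Implicit Types P : 'I_l -> seq V.

Definition free (u v : V) := e u v && [exists m, (u \in M m) && (v \in M m)].

Definition on_linkage P (uv : V * V) := [exists j, uv \in steps (P j)].

Definition cost P := #|[set uv | on_linkage P uv && ~~ free uv.1 uv.2]|.

(* If a cheaper linkage does not exist, deleting a non-free edge of a path
   leaves, by Menger, a separator with one vertex on each of the other paths:
   no [M m] that avoids it can cross it. *)
Lemma linkage_cut P (d : V) (i0 : 'I_l) q :
  linkage e A B P -> (forall P', linkage e A B P' -> cost P <= cost P') ->
  q.+1 < size (P i0) -> ~~ free (nth d (P i0) q) (nth d (P i0) q.+1) ->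
  exists (S : {set V}) (sg : 'I_l -> nat),
    [/\ #|S| < l, sg i0 = q.+1 &
        forall m, [disjoint M m & S] ->
          (forall j p, p < size (P j) -> nth d (P j) p \in M m -> p < sg j) \/
          (forall j p, p < size (P j) -> nth d (P j) p \in M m -> sg j <= p)].
Proof.
move=> lP minP; set x := nth d (P i0) q; set y := nth d (P i0) q.+1 => ltq nf.
have [hP uP dP] := lP.
pose e' : rel V := fun u v => free u v || (on_linkage P (u, v) && ((u, v) != (x, y))).
have linkE u v : on_linkage P (u, v) -> e u v.
  case/existsP=> j; have [a [p [-> pp _ _]]] := hP j.
  by move: pp; rewrite path_steps => /allP h /h.
have e'e : subrel e' e by move=> u v /orP[/andP[]|/andP[/linkE]].
(* A linkage in [e'] would be cheaper than [P]: its non-free edges are among those of [P], and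
   [(x, y)] is missing. *)
have nl : ~ lnk e' A B l.
  case/menger=> P' lP'; have := minP _ (linkage_sub e'e lP').
  apply/negP; rewrite -ltnNge; apply: proper_card; apply/properP; split.
    apply/subsetP=> [[u v]]; rewrite !inE => /andP[/existsP[j uvj] nfr].
    rewrite nfr andbT; have [hP' _ _] := lP'; have [a [p [E pp _ _]]] := hP' j.
    move: uvj pp; rewrite E path_steps => uvj /allP/(_ _ uvj)/orP[fr|/andP[]//].
    by rewrite fr in nfr.
  exists (x, y); rewrite !inE /= nf ?andbT; first by apply/existsP; exists i0; apply: mem_steps.
  apply/existsP=> [[j xyj]]; have [hP' _ _] := lP'; have [a [p [E pp _ _]]] := hP' j.
  move: xyj pp; rewrite E path_steps => uvj /allP/(_ _ uvj)/orP[fr|/andP[_]/=].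
    by rewrite /= fr in nf.
  by rewrite eqxx.
have [S [cS sep]] := not_lnkP nl.
have e'step j t : t.+1 < size (P j) -> (j, t) != (i0, q) -> e' (nth d (P j) t) (nth d (P j) t.+1).
  move=> lt; apply: contraNT; rewrite /e' negb_or => /andP[_].
  have -> : on_linkage P (nth d (P j) t, nth d (P j) t.+1).
    by apply/existsP; exists j; apply: mem_steps.
  rewrite /= negbK => /eqP[E _].
  have ji : j = i0.
    by apply: (dP _ _ x); [rewrite -E|]; apply: mem_nth; apply: ltnW.
  rewrite ji in lt E *; rewrite xpair_eqE eqxx /=.
  by rewrite -(nth_uniq d _ _ (uP i0)) ?E ?eqxx //; apply: ltnW.
have szP j : 0 < size (P j) by have [a [p [-> _ _ _]]] := hP j.
have hdA j : nth d (P j) 0 \in A by have [a [p [-> _ ? _]]] := hP j.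
have ltB j : nth d (P j) (size (P j)).-1 \in B.
  by have [a [p [-> _ _ ?]]] := hP j; rewrite nth_last.
have hit j : j != i0 -> exists s, s \in P j /\ s \in S.
  move=> ji; apply: NNPP => no.
  have nS t : t < size (P j) -> nth d (P j) t \notin S.
    by move=> lt; apply/negP=> tS; apply: no; exists (nth d (P j) t); rewrite mem_nth.
  apply: (negP (sep (nth d (P j) 0) (nth d (P j) (size (P j)).-1) _ _)).
  - by rewrite inE hdA nS.
  - by rewrite inE ltB nS // prednK.
  apply: connect_nth => // t ht; rewrite /= !inE !nS; [|lia|lia].
  by rewrite /= e'step // ?xpair_eqE ?(negPf ji) //; lia.
have hit' j : exists s, j != i0 -> s \in P j /\ s \in S.
  by case: (eqVneq j i0) => [_|/hit[s hs]]; [exists d | exists s].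
have [s hs] := fin_all_exists hit'.
have sinj : {in [set~ i0] &, injective s}.
  move=> j j'; rewrite !inE => /hs[h1 _] /hs[h2 _] E; apply: (dP _ _ (s j)) => //.
  by rewrite E.
(* Each of the [l - 1] other paths meets [S], which has at most [l - 1] vertices: each has exactly
   one vertex in [S], and [P i0] has none. *)
have SE : s @: [set~ i0] = S.
  apply/eqP; rewrite eqEcard; apply/andP; split.
    by apply/subsetP=> v /imsetP[j]; rewrite !inE => /hs[_ ?] ->.
  by rewrite card_in_imset // cardsC1 card_ord; lia.
have inS j v : v \in P j -> v \in S -> j != i0 /\ v = s j.
  move=> vP; rewrite -SE => /imsetP[j']; rewrite !inE => ji E.
  have [sj _] := hs _ ji; rewrite -E in sj; have <- := dP _ _ _ sj vP.
  by split.
pose sg j := if j == i0 then q.+1 else index (s j) (P j).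
(* The side of [A]. On path [j] it contains the positions before [sg j] and none after the cut. A
   set [M m] that avoids [S] is connected by free edges, all kept in [e'], so it lies wholly inside
   [X] or wholly outside. *)
pose X := [set v | [exists a in A :\: S, connect (restr e' (~: S)) a v]].
have nS j t : t < size (P j) -> (j != i0 -> t != sg j) -> nth d (P j) t \notin S.
  move=> lt ne; apply/negP=> /(inS _ _ (mem_nth d lt))[ji E].
  have := ne ji; rewrite /sg (negPf ji) -E index_uniq ?eqxx //.
have before j p : p < size (P j) -> p < sg j -> nth d (P j) p \in X.
  move=> lp lsg; rewrite inE; apply/existsP; exists (nth d (P j) 0).
  have nS' t : t <= p -> nth d (P j) t \notin S by move=> tp; apply: nS; lia.
  rewrite inE hdA nS' //=; apply: connect_nth => // t ht.
  rewrite /= !inE !nS' /=; [|lia|lia].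
  apply: e'step; first by lia.
  rewrite xpair_eqE negb_and; case: eqP => //= ji.
  by move: lsg; rewrite /sg ji eqxx; lia.
have after j p : p < size (P j) -> sg j <= p -> (j != i0 -> p != sg j) -> nth d (P j) p \notin X.
  move=> lp lsg ne; rewrite inE; apply/existsP=> [[a /andP[aA ca]]].
  have nS' t : p <= t < size (P j) -> nth d (P j) t \notin S.
    by move=> tp; apply: nS; [lia | move=> /ne; lia].
  apply: (negP (sep _ (nth d (P j) (size (P j)).-1) aA _)).
    by rewrite inE ltB nS' //; lia.
  apply: connect_trans ca _; apply: connect_nth => [|t ht]; first by lia.
  rewrite /= !inE !nS' /=; [|lia|lia].
  apply: e'step; first by lia.
  rewrite xpair_eqE negb_and; case: eqP => //= ji.
  by move: lsg; rewrite /sg ji eqxx; lia.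
exists S, sg; split=> //; first by rewrite /sg eqxx.
move=> m dis.
have allX u v : u \in M m -> v \in M m -> u \in X -> v \in X.
  move=> uM vM; rewrite !inE => /existsP[a /andP[aA ca]]; apply/existsP; exists a.
  rewrite aA /=; apply: connect_trans ca _; have [_ cM] := conM m.
  apply: connect_sub (cM _ _ uM vM) => w z /and3P[wM zM wz]; apply: connect1.
  rewrite /= !inE (disjointFr dis wM) (disjointFr dis zM) /= /e' /free wz /=.
  by apply/orP; left; apply/existsP; exists m; rewrite wM.
case: (classic (exists u, u \in M m /\ u \in X)) => [[u [uM uX]]|noX].
  left=> j p lp pM; rewrite ltnNge; apply/negP=> lsg.
  apply: (negP (after j p lp lsg _)); last exact: allX uM pM uX.
  move=> ji; apply/negP=> /eqP E; have [sP sS] := hs _ ji.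
  have := disjointFr dis pM; rewrite E /sg (negPf ji) nth_index ?sS //.
right=> j p lp pM; rewrite leqNgt; apply/negP=> lsg; apply: noX.
by exists (nth d (P j) p); split=> //; apply: before.
Qed.

End Cut.

(** * Ordered crossings *)

Lemma connect_leave (V : finType) (e : rel V) (M D : {set V}) x z :
  connect (restr e M) x z -> x \in D -> z \notin D ->
  exists u v, [/\ u \in D, v \in M :\: D & e u v].
Proof.
case/connectP=> p; elim: p x => [|y p IH] x /=; first by move=> _ -> ->.
case/andP=> /and3P[xM yM xy] pp lst xD zD.
by case: (boolP (y \in D)) => yD; [apply: IH pp lst yD zD | exists x, y; rewrite inE yM yD].
Qed.

(** Cells grow from the sets [F h] one vertex at a time; since [M] is connected, growth stops only
    when [M] is exhausted. A cell need not be connected, as [M] may meet [F h] in several places: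
    each vertex is only joined inside its cell to some vertex of [F h], and later the path playing
    the role of [F h] connects the pieces. *)
Lemma voronoi (V : finType) (e : rel V) (K : finType) (F : K -> {set V}) (M : {set V}) :
  symmetric e -> conn e M -> (forall h h' x, x \in F h -> x \in F h' -> h = h') ->
  (exists h x, x \in M :&: F h) ->
  exists g : V -> K,
    (forall h x, x \in M -> x \in F h -> g x = h) /\
    (forall x, x \in M ->
       exists2 y, y \in M :&: F (g x) & connect (restr e [set z in M | g z == g x]) x y).
Proof.
move=> se [_ cM] dF [h0 [x0 /setIP[x0M x0F]]].
pose g0 x := odflt h0 [pick h | x \in F h].
have g0E h x : x \in F h -> g0 x = h.
  by move=> xF; rewrite /g0; case: pickP => [h' /dF/(_ xF)//|/(_ h)]; rewrite xF.
suff main n (D : {set V}) (g : V -> K) : #|M :\: D| < n -> D \subset M -> x0 \in D ->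
    (forall h x, x \in M -> x \in F h -> x \in D /\ g x = h) ->
    (forall x, x \in D -> exists2 y, y \in M :&: F (g x) &
        connect (restr e [set z in D | g z == g x]) x y) ->
    exists g : V -> K, (forall h x, x \in M -> x \in F h -> g x = h) /\
    (forall x, x \in M ->
       exists2 y, y \in M :&: F (g x) & connect (restr e [set z in M | g z == g x]) x y).
  apply: (main _ [set x in M | [exists h, x \in F h]] g0 (ltnSn _)).
  - by apply/subsetP=> x; rewrite inE => /andP[].
  - by rewrite inE x0M; apply/existsP; exists h0.
  - move=> h x xM xF; split; last exact: g0E.
    by rewrite inE xM; apply/existsP; exists h.
  - move=> x; rewrite inE => /andP[xM /existsP[h xF]]; exists x; last exact: connect0.
    by rewrite inE xM (g0E _ _ xF).
elim: n D g => // n IH D g cD sD x0D gF gD.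
case: (boolP (M \subset D)) => [MD|/subsetPn[z zM zD]].
  have -> : M = D by apply/eqP; rewrite eqEsubset MD.
  exists g; split=> [h x xD xF|x /gD]; last by rewrite (_ : M = D) //; apply/eqP; rewrite eqEsubset MD.
  by have [] := gF h x (subsetP sD _ xD) xF.
have [u [v [uD /setDP[vM vD] uv]]] := connect_leave (cM _ _ x0M zM) x0D zD.
pose g' x := if x == v then g u else g x.
have g'D x : x \in D -> g' x = g x.
  by rewrite /g'; case: eqP => // ->; rewrite (negPf vD).
have g'v : g' v = g u by rewrite /g' eqxx.
have sub k : [set z in D | g z == k] \subset [set z in v |: D | g' z == k].
  by apply/subsetP=> w; rewrite !inE => /andP[wD]; rewrite g'D // wD orbT.
apply: (IH (v |: D) g').
- apply: leq_trans (_ : #|M :\: D| <= n); last by rewrite -ltnS.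
  apply: proper_card; apply/properP; split; first by apply: setDS; apply: subsetUr.
  by exists v; rewrite !inE ?eqxx // vM vD.
- by rewrite subUset sub1set vM.
- by rewrite inE x0D orbT.
- by move=> h x xM xF; have [xD gx] := gF h x xM xF; rewrite inE xD orbT g'D.
move=> x; rewrite in_setU1 => /orP[/eqP->|xD]; last first.
  by rewrite g'D //; have [y yF cy] := gD x xD; exists y => //; apply: restr_sub cy.
have [y yF cy] := gD u uD; exists y; rewrite g'v //.
apply: connect_trans (restr_sub (sub _) cy); apply: connect1.
by rewrite /= !inE eqxx g'v eqxx uD orbT g'D // eqxx se.
Qed.

(** The Cartesian product of [G] with a path on [N] vertices. *)
Definition prod_path (K : finType) (G : rel K) N : rel (K * 'I_N) :=
  fun x y => ((x.1 == y.1) && ((x.2.+1 == y.2) || (y.2.+1 == x.2))) || ((x.2 == y.2) && G x.1 y.1).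

(** The branch set of [(h, n)] is the segment of [P h] from position [sg n h] up to [sg n.+1 h],
    together with the cell of [h] in [W n]. Successive segments are adjacent along [P h], and edges
    inside [W n] between cells realise [G]. Since [W n] meets [P h] only inside that segment,
    positions on the paths tell the branch sets apart. *)
Lemma product_minor (V : finType) (e : rel V) k (P : 'I_k -> seq V) N (W : nat -> {set V})
    (sg : nat -> 'I_k -> nat) (g : nat -> V -> 'I_k) (G : rel 'I_k) (d : V) :
  symmetric e ->
  (forall h t, t.+1 < size (P h) -> e (nth d (P h) t) (nth d (P h) t.+1)) ->
  (forall h, uniq (P h)) -> (forall h h' x, x \in P h -> x \in P h' -> h = h') ->
  (forall n n' x, n < N -> n' < N -> x \in W n -> x \in W n' -> W n = W n') ->
  (forall n h, n < N -> exists2 x, x \in W n & x \in P h) ->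
  (forall n h p, n < N -> p < size (P h) -> nth d (P h) p \in W n -> sg n h <= p < sg n.+1 h) ->
  (forall n h x, n < N -> x \in W n -> x \in P h -> g n x = h) ->
  (forall n x, n < N -> x \in W n -> exists y, [/\ y \in W n, y \in P (g n x) &
        connect (restr e [set z in W n | g n z == g n x]) x y]) ->
  (forall n h h', n < N -> G h h' -> exists u v, [/\ u \in W n, v \in W n, e u v, g n u = h & g n v = h']) ->
  minor (prod_path G (N := N)) e.
Proof.
move=> se eP uP dP dW meet sgW gP gW GW.
have sgW' n h x : n < N -> x \in W n -> x \in P h -> sg n h <= index x (P h) < sg n.+1 h.
  by move=> nN xW xP; apply: sgW; rewrite ?index_mem ?nth_index.
have lt1 n h : n < N -> sg n h < sg n.+1 h.
  by move=> nN; have [x xW xP] := meet n h nN; have := sgW' _ _ _ nN xW xP; lia.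
have ltsz n h : n < N -> sg n h < size (P h).
  move=> nN; have [x xW xP] := meet n h nN; have := sgW' _ _ _ nN xW xP.
  have : index x (P h) < size (P h) by rewrite index_mem.
  lia.
have mono n n' h : n < n' -> n' <= N -> sg n.+1 h <= sg n' h.
  elim: n' => // n' IH; rewrite ltnS leq_eqVlt => /orP[/eqP->//|lt] le.
  by apply: leq_trans (IH lt (ltnW le)) _; apply: ltnW; apply: lt1.
have sg_inj n n' h p : n < N -> n' < N -> sg n h <= p < sg n.+1 h ->
    sg n' h <= p < sg n'.+1 h -> n = n'.
  move=> nN n'N h1 h2; case: (ltngtP n n') => // lt.
    by have := mono _ _ h lt (ltnW n'N); lia.
  by have := mono _ _ h lt (ltnW nN); lia.
pose seg h n := [set x | (x \in P h) && (sg n h <= index x (P h) < sg n.+1 h)].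
pose pc h n := [set x in W n | g n x == h].
pose phi (z : 'I_k * 'I_N) := seg z.1 z.2 :|: pc z.1 z.2.
have nseg h n p : p < size (P h) -> sg n h <= p < sg n.+1 h -> nth d (P h) p \in seg h n.
  by move=> lp int; rewrite inE mem_nth // index_uniq.
exists phi; split.
- case=> h n; set c := nth d (P h) (sg n h).
  have nN := ltn_ord n.
  have cseg : c \in seg h n by apply: nseg; [apply: ltsz | have := lt1 n h nN; lia].
  have toc x : x \in seg h n -> connect (restr e (phi (h, n))) x c.
    rewrite inE => /andP[xP int]; rewrite (sym_connect_sym (restr_sym _ se)).
    rewrite -[x in connect _ _ x](nth_index d xP); apply: connect_nth => [|t ht]; first by lia.
    have isz : index x (P h) < size (P h) by rewrite index_mem.
    rewrite /= eP; last by lia.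
    by rewrite !in_setU /= !nseg //; lia.
  apply: (@conn_star _ _ _ c) => //; first by rewrite inE cseg.
  move=> x; rewrite in_setU => /orP[/toc//|]; rewrite inE => /andP[xW /eqP gx].
  have [y [yW yP cy]] := gW _ _ nN xW; rewrite gx in yP cy.
  apply: connect_trans (toc y _); last by rewrite inE yP (sgW' n).
  by apply: restr_sub cy; apply: subsetUr.
- case=> h n [h' n'] ne; rewrite -setI_eq0; apply/eqP/setP=> x; rewrite in_setI in_set0.
  have nN := ltn_ord n; have n'N := ltn_ord n'.
  apply: contraNF ne => /andP[/setUP x1 /setUP x2]; move: x1 x2; rewrite /= !inE.
  case=> /andP[a1 a2] [/andP[b1 b2]|/andP[b1 b2]].
  + have E := dP _ _ _ a1 b1; rewrite -E in b2 *.
    by have /val_inj-> := sg_inj _ _ _ _ nN n'N a2 b2.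
  + have E := gP _ _ _ n'N b1 a1; rewrite E in b2; rewrite -(eqP b2).
    by have /val_inj-> := sg_inj _ _ _ _ nN n'N a2 (sgW' _ _ _ n'N b1 a1).
  + have E := gP _ _ _ nN a1 b1; rewrite E in a2; rewrite -(eqP a2).
    by have /val_inj-> := sg_inj _ _ _ _ nN n'N (sgW' _ _ _ nN a1 b1) b2.
  + have E := dW _ _ _ nN n'N a1 b1; have [y yW yP] := meet n h nN.
    have yW' : y \in W n' by rewrite -E.
    have /val_inj E' := sg_inj _ _ _ _ nN n'N (sgW' _ _ _ nN yW yP) (sgW' _ _ _ n'N yW' yP).
    by rewrite E' in a2 *; rewrite -(eqP a2) (eqP b2).
- have hor h (n n' : 'I_N) : n.+1 = n' -> adjacent e (phi (h, n)) (phi (h, n')).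
    move=> E; have nN := ltn_ord n; have n'N := ltn_ord n'.
    have := lt1 n h nN; have := ltsz n' h n'N; have := lt1 n' h n'N; rewrite -E => l1 l2 l3.
    exists (nth d (P h) (sg n.+1 h).-1), (nth d (P h) (sg n.+1 h)); split.
    + by rewrite inE /= nseg //; lia.
    + by rewrite inE /= -E nseg //; lia.
    + by rewrite -{2}(@prednK (sg n.+1 h)); [apply: eP|]; lia.
  case=> h n [h' n']; rewrite /prod_path /=.
  case/orP=> /andP[/eqP <-]; last first.
    move=> /(GW _ _ _ (ltn_ord n))[u [v [uW vW uv gu gv]]].
    by exists u, v; split; rewrite // !inE ?uW ?vW ?gu ?gv eqxx orbT.
  case/orP=> /eqP E; first exact: hor.
  by have [u [v [uu vv uv]]] := hor h _ _ E; exists v, u; rewrite se.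
Qed.

(** The sets are sorted by their first hit on [P i0] and split into [N.+2] blocks of [2 * l], with a
    cut from [linkage_cut] at each of the [N.+1] block boundaries. A cut has fewer than [l]
    vertices, so among the [2 * l] disjoint sets between two successive cuts one avoids both. Its
    hit on [P i0] shows on which side of each cut it lies, and this then holds on all paths at once.
    The first and last blocks lie outside the extreme cuts. *)
Lemma ordered_crossing (V : finType) (e : rel V) (I : finType) (M : I -> {set V})
    (A B : {set V}) l (P : 'I_l -> seq V) (d : V) (i0 : 'I_l) N (Y : {set I}) :
  (forall m, conn e (M m)) ->
  (forall m m' x, x \in M m -> x \in M m' -> m = m') ->
  linkage e A B P -> (forall P' : 'I_l -> seq V, linkage e A B P' -> cost e M P <= cost e M P') ->
  N.+2 * (2 * l) <= #|Y| ->
  (forall m, m \in Y -> exists2 x, x \in M m & x \in P i0) ->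
  exists (w : nat -> I) (sg : nat -> 'I_l -> nat), forall n, n < N ->
    w n \in Y /\
    (forall j p, p < size (P j) -> nth d (P j) p \in M (w n) -> sg n j <= p < sg n.+1 j).
Proof.
move=> conM dM lP minP cY meet.
have lpos : 0 < l := leq_ltn_trans (leq0n _) (ltn_ord i0).
have [m0 m0Y] : exists m, m \in Y.
  by apply/set0Pn; rewrite -card_gt0; apply: leq_trans cY; rewrite !muln_gt0 lpos.
pose pos m := find (mem (M m)) (P i0).
have posP m : m \in Y -> pos m < size (P i0) /\ nth d (P i0) (pos m) \in M m.
  move=> /meet[x xM xP]; have h : has (mem (M m)) (P i0) by apply/hasP; exists x.
  by rewrite -has_find h; split=> //; apply: (nth_find d h).
pose s := sort (fun a b => pos a <= pos b) (enum Y).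
have szs : size s = #|Y| by rewrite size_sort -cardE.
have us : uniq s by rewrite sort_uniq enum_uniq.
have sY i : i < #|Y| -> nth m0 s i \in Y.
  by rewrite -szs => lt; rewrite -mem_enum -(mem_sort (fun a b => pos a <= pos b)) mem_nth.
have tr : transitive (fun a b => pos a <= pos b) by move=> a b c; apply: leq_trans.
have srt : sorted (fun a b => pos a <= pos b) s.
  by apply: sort_sorted => a b; apply: leq_total.
have sle i j : i <= j -> j < #|Y| -> pos (nth m0 s i) <= pos (nth m0 s j).
  move=> ij jY; apply: (sorted_leq_nth tr _ _ srt) => //; rewrite ?inE ?szs //.
  exact: leq_ltn_trans jY.
have slt i : i.+1 < #|Y| -> pos (nth m0 s i) < pos (nth m0 s i.+1).
  move=> lt; rewrite ltn_neqAle sle // andbT; apply/eqP=> E.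
  have [_ h1] := posP _ (sY _ (ltnW lt)); have [_ h2] := posP _ (sY _ lt).
  rewrite -E in h2; have /eqP := dM _ _ _ h1 h2.
  by rewrite nth_uniq ?szs //; [lia | apply: ltnW].
(* A stretch of [P i0] made of free edges stays in a single [M m], so a non-free edge lies between
   the first hits of two different sets. *)
have cut i : i.+1 < #|Y| -> exists q, pos (nth m0 s i) <= q < pos (nth m0 s i.+1) /\
    ~~ free e M (nth d (P i0) q) (nth d (P i0) q.+1).
  move=> lt; apply: NNPP => no.
  have [_ h1] := posP _ (sY _ (ltnW lt)); have [_ h2] := posP _ (sY _ lt).
  have {}no t : pos (nth m0 s i) <= t <= pos (nth m0 s i.+1) ->
      nth d (P i0) t \in M (nth m0 s i).
    elim: t => [|t IH] ht; first by have <- : pos (nth m0 s i) = 0 by lia.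
    case: (leqP (pos (nth m0 s i)) t) => ht'; last first.
      by have <- : pos (nth m0 s i) = t.+1 by lia.
    have tM : nth d (P i0) t \in M (nth m0 s i) by apply: IH; lia.
    have : free e M (nth d (P i0) t) (nth d (P i0) t.+1).
      by apply: contraT => nf; case: no; exists t; split=> //; lia.
    by case/andP=> _ /existsP[m /andP[tm tm1]]; rewrite (dM _ _ _ tM tm).
  have h3 : nth d (P i0) (pos (nth m0 s i.+1)) \in M (nth m0 s i).
    by apply: no; rewrite leqnn andbT; apply: ltnW; apply: slt.
  have := slt _ lt; by rewrite (dM _ _ _ h2 h3) ltnn.
pose b := 2 * l.
have cuts (n : 'I_N.+1) : exists x : {set V} * ('I_l -> nat),
    [/\ #|x.1| < l, pos (nth m0 s (n.+1 * b).-1) < x.2 i0 <= pos (nth m0 s (n.+1 * b)) &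
        forall m, [disjoint M m & x.1] ->
          (forall j p, p < size (P j) -> nth d (P j) p \in M m -> p < x.2 j) \/
          (forall j p, p < size (P j) -> nth d (P j) p \in M m -> x.2 j <= p)].
  have nN := ltn_ord n.
  have lb : (n.+1 * b).-1.+1 = n.+1 * b by rewrite prednK // muln_gt0 /b; lia.
  have lt : n.+1 * b < #|Y|.
    by apply: leq_trans cY; rewrite ltn_pmul2r ?ltnS //; rewrite /b; lia.
  have := cut (n.+1 * b).-1; rewrite lb => /(_ lt)[q [hq nf]].
  have [psz _] := posP _ (sY _ lt).
  have [|S [sg [cS E cS']]] := linkage_cut conM lP minP _ nf; first by lia.
  by exists (S, sg); rewrite /= E; split=> //; lia.
have [c cP] := fin_all_exists cuts.
have wex (n : 'I_N) : exists m, m \in Y /\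
    (forall j p, p < size (P j) -> nth d (P j) p \in M m ->
      (c (inord n)).2 j <= p < (c (inord n.+1)).2 j).
  have nN := ltn_ord n.
  have [] := cP (inord n); have [] := cP (inord n.+1); rewrite !inordK; [|lia|lia].
  set S1 := (c (inord n)).1; set S2 := (c (inord n.+1)).1.
  set s1 := (c (inord n)).2; set s2 := (c (inord n.+1)).2 => cS2 hs2 cut2 cS1 hs1 cut1.
  have lt t : t < b -> n.+1 * b + t < #|Y|.
    move=> tb; apply: leq_trans cY; rewrite -/b; apply: leq_trans (_ : n.+2 * b <= _).
      by rewrite [n.+2 * b]mulSn addnC ltn_add2r.
    by rewrite leq_mul2r; apply/orP; right; lia.
  have [t dis] : exists t : 'I_b, [disjoint M (nth m0 s (n.+1 * b + t)) & S1 :|: S2].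
    apply: NNPP => no.
    have hx (t : 'I_b) : exists x, x \in M (nth m0 s (n.+1 * b + t)) /\ x \in S1 :|: S2.
      case: (pickP [pred x | (x \in M (nth m0 s (n.+1 * b + t))) && (x \in S1 :|: S2)]).
        by move=> x /andP[]; exists x.
      move=> none; case: no; exists t; rewrite -setI_eq0; apply/eqP/setP=> x.
      by rewrite in_setI in_set0; apply: none.
    have [f fP] := fin_all_exists hx.
    have finj : injective f.
      move=> t t' E; have [h1 _] := fP t; have [h2 _] := fP t'; rewrite -E in h2.
      have /eqP := dM _ _ _ h1 h2; rewrite nth_uniq ?szs ?lt // eqn_add2l => /eqP.
      exact: val_inj.
    have : #|f @: [set: 'I_b]| <= #|S1 :|: S2|.
      by apply: subset_leq_card; apply/subsetP=> x /imsetP[t _ ->]; have [] := fP t.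
    rewrite card_imset // cardsT card_ord cardsU; rewrite /b; lia.
  set m := nth m0 s _ in dis; have tb := ltn_ord t.
  have mY : m \in Y by apply: sY; apply: lt.
  have [psz pM] := posP _ mY.
  have d1 : [disjoint M m & S1] by apply: disjointWr dis; apply: subsetUl.
  have d2 : [disjoint M m & S2] by apply: disjointWr dis; apply: subsetUr.
  have ge : pos (nth m0 s (n.+1 * b)) <= pos m by apply: sle; [lia | apply: lt].
  have le : pos m <= pos (nth m0 s (n.+2 * b).-1).
    apply: sle; first by rewrite [n.+2 * b]mulSn; lia.
    have := lt b.-1 ltac:(rewrite /b; lia); have -> : n.+1 * b + b.-1 = (n.+2 * b).-1 => //.
    by rewrite [n.+2 * b]mulSn /b; lia.
  exists m; split=> // j p lp pMm; apply/andP; split.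
    have [/(_ i0 _ psz pM)|] := cut1 _ d1; last exact.
    by move=> bad; exfalso; lia.
  have [|/(_ i0 _ psz pM)] := cut2 _ d2; first exact.
  by move=> bad; exfalso; lia.
have [w wP] := fin_all_exists wex.
exists (fun n => if insub n is Some i then w i else m0), (fun n => (c (inord n)).2) => n nN.
by rewrite insubT /=; apply: (wP (Ordinal nN)).
Qed.

(** * Grids from crossing families *)

Lemma card_bigcup_le (I V : finType) (D : {pred I}) (F : I -> {set V}) b :
  (forall i, i \in D -> #|F i| <= b) -> #|\bigcup_(i in D) F i| <= #|D| * b.
Proof.
move=> h; rewrite -sum_nat_const; elim/big_rec2: _ => [|i S n iD IH]; first by rewrite cards0.
by rewrite cardsU; have := h i iD; lia.
Qed.

Lemma pigeonhole (I C : finType) (f : I -> C) (Y : {set I}) b :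
  #|C| * b < #|Y| -> exists c, b < #|[set m in Y | f m == c]|.
Proof.
move=> lt; apply: NNPP => no; move: lt; apply/negP; rewrite -leqNgt.
have -> : Y = \bigcup_(c in C) [set m in Y | f m == c].
  apply/setP=> m; apply/idP/bigcupP=> [mY|[c _]]; last by rewrite inE => /andP[].
  by exists (f m); rewrite // inE mY eqxx.
apply: card_bigcup_le => c _; rewrite leqNgt; apply/negP=> lt; apply: no; by exists c.
Qed.

(** If every vertex has fewer than [r] neighbours other than itself, a ball of radius [r] has at
    most [r ^ r] vertices, and a simple path to a vertex outside it has at least [r] edges. Loops
    are discounted because the graphs used later may have them, from edges inside one cell. *)
Lemma path_or_star (K : finType) (G : rel K) r :
  (forall x y, connect G x y) -> r ^ r < #|K| ->
  (exists x p, [/\ uniq (x :: p), path G x p & r <= size p]) \/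
  (exists c, r <= #|[set y | G c y && (y != c)]|).
Proof.
move=> cG cK; apply: NNPP => /not_or_and[noP noS].
have deg c : #|[set y | G c y && (y != c)]| < r.
  by rewrite ltnNge; apply/negP=> le; apply: noS; exists c.
have [x0 _] : exists x : K, x \in K by apply/card_gt0P; apply: leq_trans cK.
pose next (D : {set K}) := \bigcup_(y in D) (y |: [set z | G y z && (z != y)]).
pose D n := iter n next [set x0].
have cD n : #|D n| <= r ^ n.
  elim: n => [|n IH]; first by rewrite cards1.
  rewrite expnSr; apply: leq_trans (_ : #|D n| * r <= _); last by rewrite leq_mul2r IH orbT.
  by apply: card_bigcup_le => y _; rewrite cardsU1; have := deg y; lia.
have sD n n' : n <= n' -> D n \subset D n'.
  move=> /subnK <-; elim: (n' - n) => // t IH; apply: subset_trans IH _.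
  by apply/subsetP=> y yD; apply/bigcupP; exists y; rewrite // setU11.
have [z zD] : exists z, z \notin D r.
  apply: NNPP => no; have : #|K| <= #|D r|.
    apply: subset_leq_card; apply/subsetP=> z _.
    by apply: contraT => zD; case: no; exists z.
  by have := cD r; lia.
have /connectP[p0 pp0 lst0] := cG x0 z.
case/shortenP: pp0 lst0 => p pp up _ lst.
case: (leqP r (size p)) => szp; first by apply: noP; exists x0, p.
move/negP: zD; apply; apply: (subsetP (sD _ _ (ltnW szp))); rewrite lst.
elim/last_ind: p {up lst szp} pp => [|p y IH]; first by rewrite set11.
rewrite rcons_path size_rcons last_rcons => /andP[/IH lD ly].
apply/bigcupP; exists (last x0 p); rewrite // !inE ly.
by case: eqP.
Qed.

Lemma grid_adjP n (x y : 'I_n * 'I_n) : grid_adj x y ->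
  [\/ x.1 = y.1 /\ x.2.+1 = y.2, x.1 = y.1 /\ y.2.+1 = x.2,
      x.2 = y.2 /\ x.1.+1 = y.1 | x.2 = y.2 /\ y.1.+1 = x.1].
Proof.
case: x y => i j [i' j'] /=; case/orP=> /andP[/eqP/val_inj <-] /orP[]/eqP E.
- by constructor 1.
- by constructor 2.
- by constructor 3.
- by constructor 4.
Qed.

Lemma grid_adj_neq n (x y : 'I_n * 'I_n) : grid_adj x y -> x != y.
Proof.
by move=> xy; apply/eqP=> E; move: xy; rewrite E => /grid_adjP[] [_]; lia.
Qed.

Lemma grid_minorI (V : finType) (e : rel V) n (phi : 'I_n * 'I_n -> {set V}) :
  symmetric e -> (forall x, conn e (phi x)) ->
  (forall x y u, u \in phi x -> u \in phi y -> x = y) ->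
  (forall i j j' : 'I_n, j.+1 = j' -> adjacent e (phi (i, j)) (phi (i, j'))) ->
  (forall i i' j : 'I_n, i.+1 = i' -> adjacent e (phi (i, j)) (phi (i', j))) ->
  minor (@grid_adj n) e.
Proof.
move=> se cphi dphi hor ver; exists phi; split=> // [x y xy|x y /grid_adjP].
  rewrite -setI_eq0; apply/eqP/setP=> u; rewrite in_setI in_set0; apply: contraNF xy.
  by case/andP=> /dphi h /h->.
have sadj X Y : adjacent e X Y -> adjacent e Y X.
  by case=> u [v [uX vY uv]]; exists v, u; rewrite se.
case: x y => i j [i' j'] /=.
by case=> -[<- E]; [|apply: sadj| |apply: sadj]; [apply: hor|apply: hor|apply: ver|apply: ver].
Qed.

Lemma prod_path_sym (K : finType) (G : rel K) N : symmetric G -> symmetric (prod_path G (N := N)).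
Proof.
move=> sG x y; rewrite /prod_path (eq_sym x.1) (eq_sym x.2) sG; congr (_ && _ || _).
by rewrite orbC.
Qed.

(** The product of two paths is a grid. The factor has [r * r] vertices to agree with the star case;
    here its first [r] vertices carry the columns. *)
Lemma grid_in_path (K : finType) (G : rel K) r x p : symmetric G ->
  uniq (x :: p) -> path G x p -> r <= size p -> minor (@grid_adj r) (prod_path G (N := r * r)).
Proof.
move=> sG up pp szp.
have le (j : 'I_r) : j < r * r by have := ltn_ord j; nia.
pose o j := Ordinal (le j).
apply: (@grid_minorI _ _ _ (fun z => [set (nth x (x :: p) z.1, o z.2)])).
- exact: prod_path_sym.
- by move=> z; apply: conn1.
- case=> i j [i' j'] u /set1P-> /set1P[] /eqP E E'; have ir := ltn_ord i; have i'r := ltn_ord i'.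
  have /eqP/val_inj-> : (i : nat) == i'.
    by rewrite -(nth_uniq x _ _ up) //; apply: leq_trans (leqW szp).
  by congr pair; apply: val_inj.
- move=> i j j' E; do 2![eexists]; split; [exact: set11|exact: set11|].
  by rewrite /prod_path /= eqxx E eqxx.
- move=> i i' j E; do 2![eexists]; split; [exact: set11|exact: set11|].
  rewrite /prod_path /= eqxx /= -E; apply/orP; right; apply: (pathP x pp).
  by have := ltn_ord i; have := ltn_ord i'; lia.
Qed.

(* Row [i] is the leaf [x i]; the centre is visited once per grid vertex, in its own column. *)
Lemma grid_in_star (K : finType) (G : rel K) r c : symmetric G ->
  r <= #|[set y | G c y && (y != c)]| -> minor (@grid_adj r) (prod_path G (N := r * r)).
Proof.
move=> sG le.
pose x (i : 'I_r) : K := enum_val (widen_ord le i).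
have xP i : G c (x i) /\ x i != c.
  by have := enum_valP (widen_ord le i); rewrite inE => /andP[].
have xinj : injective x.
  by move=> i i' /enum_val_inj/(congr1 val) /= /val_inj.
have lt (j a : 'I_r) : j * r + a < r * r by have := ltn_ord j; have := ltn_ord a; nia.
pose o j a := Ordinal (lt j a).
have oinj (j a j' a' : 'I_r) : j * r + a = j' * r + a' -> j = j' /\ a = a'.
  move=> E; have := ltn_ord a; have := ltn_ord a' => h h'.
  have E1 : (j : nat) = j'.
    have := congr1 (divn^~ r) E; rewrite !divnMDl ?divn_small ?addn0 //; lia.
  by split; apply: val_inj => //=; move: E; rewrite E1; lia.
(* Column [j] of the grid occupies the [r] columns [j * r + a] of the product. In the one with
   [a = i] the branch set of [(i, j)] owns the centre, through which it reaches row [i + 1]. *)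
pose phi (z : 'I_r * 'I_r) := (c, o z.2 z.1) |: [set (x z.1, o z.2 a) | a : 'I_r].
have sE := prod_path_sym (N := r * r) sG.
have inphi i j a : (x i, o j a) \in phi (i, j).
  by rewrite in_setU1; apply/orP; right; apply/imsetP; exists a.
apply: (@grid_minorI _ _ _ phi) => //.
- case=> i j; have r0 : 0 < r := leq_ltn_trans (leq0n i) (ltn_ord i).
  pose a0 := Ordinal r0.
  have row a : connect (restr (prod_path G (N := r * r)) (phi (i, j))) (x i, o j a) (x i, o j a0).
    case: a => a; elim: a => [|a IH] ar.
      by rewrite (_ : Ordinal ar = a0) //; apply: val_inj.
    apply: connect_trans (IH (ltnW ar)); apply: connect1.
    by rewrite /= !inphi /prod_path /= eqxx /= addnS eqxx orbT.
  apply: (@conn_star _ _ _ (x i, o j a0)) => //.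
  move=> z /setU1P[->|/imsetP[a _ ->]] //; apply: connect_trans (row i); apply: connect1.
  have [xc _] := xP i.
  by rewrite /= inphi in_setU1 eqxx /prod_path /= eqxx xc orbT.
- case=> i j [i' j'] u /setU1P[->|/imsetP[a _ ->]] /setU1P[[]|/imsetP[a' _ []]] /=.
  + by move=> E; have [-> ->] := oinj j i j' i' E.
  + by move=> E; have [_] := xP i'; rewrite -E eqxx.
  + by move=> E; have [_] := xP i; rewrite E eqxx.
  + by move=> /xinj-> E; have [-> _] := oinj j a j' a' E.
- move=> i j j' E; have r0 : 0 < r := leq_ltn_trans (leq0n i) (ltn_ord i).
  have lr : r.-1 < r by lia.
  exists (x i, o j (Ordinal lr)), (x i, o j' (Ordinal r0)); split=> //.
  by rewrite /prod_path /= eqxx -E mulSn /=; apply/orP; left; lia.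
- move=> i i' j E; exists (c, o j i), (x i', o j i); split=> //; first by rewrite in_setU1 eqxx.
  by have [xc _] := xP i'; rewrite /prod_path /= eqxx xc orbT.
Qed.

(** For a set that meets [k] chosen paths, the cells around these paths, adjacent when an edge
    inside the set joins them, form a connected graph on [k] vertices. [C] collects the possible
    choices of paths and graphs; among more than [#|C| * b] such sets, more than [b] agree on both,
    and [b] is what [ordered_crossing] asks for. Ordered along one of the common paths, they yield
    the product of the common graph with a path. *)
Theorem crossing r : exists k, forall l, exists N0,
  forall (V : finType) (e : rel V) (I : finType) (M : I -> {set V}) (A B : {set V}),
    symmetric e -> (forall m, conn e (M m)) ->
    (forall m m' x, x \in M m -> x \in M m' -> m = m') ->
    lnk e A B l ->
    minor (@grid_adj r) e \/
    exists2 P : 'I_l -> seq V, linkage e A B P &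
      #|[set m | k <= #|[set j | [exists x in M m, x \in P j]]|]| < N0.
Proof.
pose k := (r ^ r).+1; pose N := r * r; exists k => l.
pose C := ({ffun 'I_k -> 'I_l} * {ffun 'I_k * 'I_k -> bool})%type.
pose b := N.+2 * (2 * l).
exists (#|{: C}| * b).+1 => V e I M A B se conM dM lk.
have [P [lP minP]] := ex_min (@cost V e I M l) (menger lk).
pose Bad := [set m | k <= #|[set j | [exists x in M m, x \in P j]]|].
case: (leqP #|Bad| (#|{: C}| * b)) => [le|cBad].
  by right; exists P.
left; have [hP uP dP] := lP.
have one m : m \in Bad -> exists z : {ffun 'I_k -> 'I_l} * {ffun V -> 'I_k},
    [/\ forall h, exists2 x, x \in M m & x \in P (z.1 h), injective z.1,
        forall h x, x \in M m -> x \in P (z.1 h) -> z.2 x = h &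
        forall x, x \in M m -> exists y, [/\ y \in M m, y \in P (z.1 (z.2 x)) &
          connect (restr e [set w in M m | z.2 w == z.2 x]) x y]].
  rewrite inE => le.
  pose io (h : 'I_k) : 'I_l := enum_val (widen_ord le h).
  have ioP h : exists2 x, x \in M m & x \in P (io h).
    by have := enum_valP (widen_ord le h); rewrite inE => /existsP[x /andP[]]; exists x.
  have ioI : injective io by move=> h h' /enum_val_inj/(congr1 val) /= /val_inj.
  have [||g [g1 g2]] := @voronoi _ e _ (fun h => [set x in P (io h)]) _ se (conM m).
  - by move=> h h' x; rewrite !inE => h1 h2; apply: ioI; apply: dP h1 h2.
  - by have [x xM xP] := ioP ord0; exists ord0, x; rewrite !inE xM.
  exists ([ffun h => io h], [ffun x => g x]); split=> /=.
  - by move=> h; rewrite ffunE.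
  - by move=> h h'; rewrite !ffunE => /ioI.
  - by move=> h x xM; rewrite !ffunE => xP; apply: g1; rewrite ?inE.
  move=> x xM; have [y] := g2 x xM; rewrite !inE => /andP[yM yP] cy; exists y; rewrite !ffunE.
  by split=> //; apply: restr_sub cy; apply/subsetP=> w; rewrite !inE !ffunE.
have [m1 m1B] : exists m, m \in Bad by apply/set0Pn; rewrite -card_gt0; apply: leq_trans cBad.
have [z1 _] := one m1 m1B.
have all m : exists z : {ffun 'I_k -> 'I_l} * {ffun V -> 'I_k}, m \in Bad ->
    [/\ forall h, exists2 x, x \in M m & x \in P (z.1 h), injective z.1,
        forall h x, x \in M m -> x \in P (z.1 h) -> z.2 x = h &
        forall x, x \in M m -> exists y, [/\ y \in M m, y \in P (z.1 (z.2 x)) &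
          connect (restr e [set w in M m | z.2 w == z.2 x]) x y]].
  by case: (boolP (m \in Bad)) => [/one[z hz]|_]; [exists z | exists z1].
have [z zP] := fin_all_exists all.
pose Gm m := [ffun hh : 'I_k * 'I_k => [exists u in M m, exists v in M m,
  [&& e u v, (z m).2 u == hh.1 & (z m).2 v == hh.2]]].
have [[io G] cY] := pigeonhole (fun m => ((z m).1, Gm m) : C) cBad.
set Y := [set m in Bad | _] in cY.
have YP m : m \in Y -> [/\ m \in Bad, (z m).1 = io & Gm m = G].
  by rewrite inE => /andP[mB /eqP[]].
pose Gr : rel 'I_k := fun h h' => G (h, h').
have GrP m h h' : m \in Y -> Gr h h' ->
    exists u v, [/\ u \in M m, v \in M m, e u v, (z m).2 u = h & (z m).2 v = h'].
  move=> /YP[_ _ E]; rewrite /Gr -E ffunE => /existsP[u /andP[uM /existsP[v]]].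
  by case/and4P=> vM uv /eqP ? /eqP ?; exists u, v.
have GrI m u v : m \in Y -> u \in M m -> v \in M m -> e u v -> Gr ((z m).2 u) ((z m).2 v).
  move=> /YP[_ _ E] uM vM uv; rewrite /Gr -E ffunE; apply/existsP; exists u; rewrite uM.
  by apply/existsP; exists v; rewrite vM uv !eqxx.
have [m2 m2Y] : exists m, m \in Y by apply/set0Pn; rewrite -card_gt0; apply: leq_trans cY.
have sGr : symmetric Gr.
  suff imp h h' : Gr h h' -> Gr h' h by move=> h h'; apply/idP/idP; apply: imp.
  by case/(GrP _ _ _ m2Y)=> u [v [uM vM uv <- <-]]; apply: GrI; rewrite // se.
have cGr h h' : connect Gr h h'.
  have [m2B zio _] := YP _ m2Y; have [meet _ gP _] := zP _ m2B.
  have [u uM uP'] := meet h; have [v vM vP'] := meet h'.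
  rewrite -(gP _ _ uM uP') -(gP _ _ vM vP'); have [_ /(_ _ _ uM vM)/connectP[p]] := conM m2.
  elim: p u uM {uP'} => [|w p IH] u uM /=; first by move=> _ ->; apply: connect0.
  case/andP=> /and3P[_ wM uw] pp lst; apply: connect_trans (IH w wM pp lst).
  by apply: connect1; apply: GrI.
have [[d _] _] := conM m1.
have meet0 m : m \in Y -> exists2 x, x \in M m & x \in P (io ord0).
  by case/YP=> mB <- _; have [h _ _ _] := zP _ mB; apply: h.
have [w [sg wsg]] := ordered_crossing d conM dM lP minP (ltnW cY) meet0.
have gm : minor (@grid_adj r) (prod_path Gr (N := N)).
  have cK : r ^ r < #|'I_k| by rewrite card_ord.
  case: (path_or_star cGr cK) => [[x [p [up pp szp]]]|[c le]].
    exact: grid_in_path pp szp.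
  exact: grid_in_star le.
apply: (minor_trans se gm).
have wY n : n < N -> w n \in Y by move=> /wsg[].
have ioI : injective io.
  by have [m2B <- _] := YP _ m2Y; have [_ + _ _] := zP _ m2B.
apply: (@product_minor _ _ _ (fun h => P (io h)) _ (fun n => M (w n))
  (fun n h => sg n (io h)) (fun n => (z (w n)).2) Gr d se).
- move=> h t lt; have [a [p [E pp _ _]]] := hP (io h); rewrite E in lt *.
  exact: (pathP d pp).
- by move=> h.
- by move=> h h' x h1 h2; apply: ioI; apply: dP h1 h2.
- by move=> n n' x nN n'N h1 h2; rewrite (dM _ _ _ h1 h2).
- by move=> n h /wY/YP[mB <- _]; have [+ _ _ _] := zP _ mB; apply.
- by move=> n h p /wsg[_ ]; apply.
- by move=> n h x /wY/YP[mB <- _]; have [_ _ + _] := zP _ mB; apply.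
- by move=> n x /wY/YP[mB <- _]; have [_ _ _] := zP _ mB; apply.
- by move=> n h h' /wY nY; apply: GrP.
Qed.

(** * Disjoint connections *)

Lemma lnk_le (V : finType) (e : rel V) A B L L' : L <= L' -> lnk e A B L' -> lnk e A B L.
Proof. by move=> le lk S cS; apply: lk; apply: leq_trans le. Qed.

Definition hits (V : finType) l (P : 'I_l -> seq V) (X : {set V}) : {set 'I_l} :=
  [set j | [exists x in X, x \in P j]].

Lemma notin_hits (V : finType) l (P : 'I_l -> seq V) (X : {set V}) j x :
  j \notin hits P X -> x \in P j -> x \notin X.
Proof.
by rewrite inE => h xP; apply: contra h => xX; apply/existsP; exists x; rewrite xX.
Qed.

Lemma card_hits (V : finType) (e : rel V) A B l (P : 'I_l -> seq V) (S : {set V}) :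
  linkage e A B P -> #|hits P S| <= #|S|.
Proof.
move=> [_ _ dP]; rewrite -[#|S|]muln1.
have -> : hits P S = \bigcup_(x in S) [set j | x \in P j].
  apply/setP=> j; rewrite inE; apply/existsP/bigcupP=> [[x /andP[xS xP]]|[x xS]].
    by exists x; rewrite ?inE.
  by rewrite inE => xP; exists x; rewrite xS.
apply: card_bigcup_le => x _; rewrite leqNgt; apply/negP=> /card_gt1P[j [j' [+ + /eqP]]].
by rewrite !inE => xj xj'; apply; apply: dP xj xj'.
Qed.

Lemma conn_restr_sub (V : finType) (e : rel V) (X R : {set V}) a :
  conn (restr e X) R -> a \in R -> a \in X -> R \subset X.
Proof.
move=> [_ cR] aR aX; apply/subsetP=> x xR; apply: (@connect_restr_mem _ e) aX.
by apply: connect_sub (cR _ _ aR xR) => u v /and3P[_ _ uv]; apply: connect1.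
Qed.

Definition meets (V : finType) (X Y : {set V}) : Prop := exists2 x, x \in X & x \in Y.

(** Induction on the number of pairs. The last pair is joined by [d] disjoint paths, taken as the
    family for the linkages of the other pairs. Without a grid, each of the [c] other pairs rules
    out fewer than [N0] of them, so with [d = c * N0 + 1] one path meets fewer than [k] paths of
    every linkage. It becomes the last connection, and after its removal the other pairs are still
    [Lc]-linked. *)
Lemma disjoint_connections r c : exists L,
  forall (V : finType) (e : rel V) (Q : pred nat) (A B : nat -> {set V}),
    symmetric e -> (forall i, i < c -> Q i -> lnk e (A i) (B i) L) ->
    minor (@grid_adj r) e \/
    exists R : nat -> {set V},
      (forall i, i < c -> Q i -> [/\ conn e (R i), meets (R i) (A i) & meets (R i) (B i)]) /\
      (forall i j x, i < c -> j < c -> Q i -> Q j -> x \in R i -> x \in R j -> i = j).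
Proof.
have [k cross] := crossing r.
elim: c => [|c [Lc IH]]; first by exists 0 => V e Q A B _ _; right; exists (fun=> set0).
have [N0 {}cross] := cross (Lc + k).
pose d := (c * N0).+1; exists (Lc + k + d) => V e Q A B se lk.
case: (boolP (Q c)) => [Qc|nQ]; last first.
  case: (IH V e Q A B se) => [i ic Qi|mi|[R [R1 R2]]]; [|by left|].
    by apply: (lnk_le _ (lk i _ Qi)); lia.
  right; exists R; have lt i : i < c.+1 -> Q i -> i < c.
    by rewrite ltnS leq_eqVlt => /orP[/eqP->|//]; rewrite (negPf nQ).
  by split=> [i ic Qi|i j x ic jc Qi Qj]; [apply: R1 | apply: R2] => //; apply: lt.
have [D lD] : exists D : 'I_d -> seq V, linkage e (A c) (B c) D.
  by apply: menger; apply: (lnk_le _ (lk c _ Qc)); lia.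
have [hD uD dD] := lD; pose M m := [set x in D m].
have conM m : conn e (M m) by rewrite /M; have [x [p [-> pp _ _]]] := hD m; apply: conn_path.
have dM m m' x : x \in M m -> x \in M m' -> m = m' by rewrite !inE; apply: dD.
case: (classic (minor (@grid_adj r) e)) => [|ng]; first by left.
have links (i : 'I_c) : exists P : 'I_(Lc + k) -> seq V, Q i -> linkage e (A i) (B i) P /\
    #|[set m | k <= #|hits P (M m)|]| < N0.
  case: (boolP (Q i)) => Qi; last by exists (fun=> [::]).
  have lki : lnk e (A i) (B i) (Lc + k).
    apply: (lnk_le _ (lk i _ Qi)); first by lia.
    by apply: ltn_trans (ltn_ord i) _.
  by have [//|[P lP cP]] := cross V e _ M _ _ se conM dM lki; exists P.
have [P PP] := fin_all_exists links.
have [m mP] : exists m, forall i : 'I_c, Q i -> #|hits (P i) (M m)| < k.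
  apply: NNPP => no.
  have : #|'I_d| <= #|'I_c| * N0.
    rewrite -cardsT.
    have -> : [set: 'I_d] = \bigcup_(i in 'I_c) [set m | Q i && (k <= #|hits (P i) (M m)|)].
      apply/setP=> m; rewrite inE; apply/esym/bigcupP; apply: NNPP => no'; apply: no; exists m => i Qi.
      by rewrite ltnNge; apply/negP=> le; apply: no'; exists i; rewrite // inE Qi.
    apply: card_bigcup_le => i _; case: (boolP (Q i)) => Qi.
      have [_ lt] := PP i Qi; apply: leq_trans (ltnW lt).
      by apply: subset_leq_card; apply/subsetP=> m; rewrite !inE.
    by rewrite (_ : [set m | _] = set0) ?cards0 //; apply/setP=> m; rewrite !inE.
  by rewrite !card_ord /d ltnn.
pose e' := restr e (~: M m).
have se' : symmetric e' by apply: restr_sym.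
(* The vertices of [M m] remain in the type as isolated vertices, and a singleton is connected;
   taking them out of the ends keeps every [R i] away from [M m]. *)
case: (IH V e' Q (fun i => A i :\: M m) (fun i => B i :\: M m) se').
- move=> i ic Qi S cS; have [lP _] := PP (Ordinal ic) Qi; have hM := mP (Ordinal ic) Qi.
  set Pi := P (Ordinal ic) in lP hM.
  have [j jn] : exists j, j \notin hits Pi S :|: hits Pi (M m).
    apply: NNPP => no; have : #|'I_(Lc + k)| <= #|hits Pi S :|: hits Pi (M m)|.
      apply: subset_leq_card; apply/subsetP=> j _; apply: contraT => jn.
      by case: no; exists j.
    by rewrite card_ord cardsU; have := card_hits S lP; lia.
  move: jn; rewrite in_setU negb_or => /andP[jS jM].
  have [hP _ _] := lP; have [a [p [E pp aA lB]]] := hP j.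
  have nS x : x \in a :: p -> (x \notin S) && (x \notin M m).
    by rewrite -E => xP; rewrite (notin_hits jS xP) (notin_hits jM xP).
  exists a, (last a p); rewrite !in_setD aA lB !andbT; split.
  + exact: nS (mem_head _ _).
  + exact: nS (mem_last _ _).
  apply/connectP; exists p => //; apply: path_restr; last first.
    by move=> x /nS/andP[xS _]; rewrite inE.
  by apply: path_restr => // x /nS/andP[_ xM]; rewrite inE.
- by move=> mi; left; apply: minor_sub mi => u v /and3P[].
case=> R [R1 R2]; right.
have RM i x : i < c -> Q i -> x \in R i -> x \notin M m.
  move=> ic Qi xR; have [cR [a aR aA] _] := R1 i ic Qi.
  have aM : a \in ~: M m by move: aA; rewrite !inE => /andP[].
  by have := subsetP (conn_restr_sub cR aR aM) x xR; rewrite inE.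
exists (fun i => if i == c then M m else R i); split=> [i|i j x].
  rewrite ltnS leq_eqVlt; case: (eqVneq i c) => [-> _ _|_ /= ic Qi].
    have [x [p [E _ xA lB]]] := hD m; split=> //.
      by exists x; rewrite // inE E mem_head.
    by exists (last x p); rewrite // inE E mem_last.
  have [cR [a aR]] := R1 i ic Qi; rewrite inE => /andP[_ aA] [b bR]; rewrite inE => /andP[_ bB].
  split; [|by exists a|by exists b].
  by apply: conn_sub cR => u v _ _ /and3P[].
rewrite !ltnS [i <= c]leq_eqVlt [j <= c]leq_eqVlt; case: (eqVneq i c) => [->|_]; case: (eqVneq j c) => [->|_] //=.
- by move=> _ jc _ Qj xM /(RM _ _ jc Qj); rewrite xM.
- by move=> ic _ Qi _ /(RM _ _ ic Qi) /negPf->.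
- exact: R2.
Qed.

Lemma disjoint_connections_fin r (J : finType) : exists L,
  forall (V : finType) (e : rel V) (Q : pred J) (A B : J -> {set V}),
    symmetric e -> (forall i, Q i -> lnk e (A i) (B i) L) ->
    minor (@grid_adj r) e \/
    exists R : J -> {set V},
      (forall i, Q i -> [/\ conn e (R i), meets (R i) (A i) & meets (R i) (B i)]) /\
      (forall i j x, Q i -> Q j -> x \in R i -> x \in R j -> i = j).
Proof.
have [L h] := disjoint_connections r #|J|; exists L => V e Q A B se lk.
pose ext T (d : T) (f : J -> T) i := if insub i is Some i' then f (enum_val (i' : 'I_#|J|)) else d.
have extE T (d : T) f j : ext T d f (enum_rank j) = f j by rewrite /ext valK enum_rankK.
have [i ic|//|[R [R1 R2]]] := h V e (ext _ false Q) (ext _ set0 A) (ext _ set0 B) se.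
- by rewrite /ext insubT; apply: lk.
- by left.
right; exists (fun j => R (enum_rank j)); split=> [i Qi|i j x Qi Qj xi xj].
  by have := R1 (enum_rank i) (ltn_ord _); rewrite !extE; apply.
by apply: enum_rank_inj; apply: val_inj; apply: (R2 _ _ x); rewrite ?ltn_ord ?extE.
Qed.

(* Union bound over all maps [K -> T]. *)
Lemma free_set (K T : finType) (F : T -> T -> {set T}) N :
  (forall a b, #|F a b| <= N) -> #|{: K * K * K}| * N < #|T| ->
  exists f : {ffun K -> T}, forall x y z, z != x -> z != y -> f z \notin F (f x) (f y).
Proof.
move=> cF lt; apply: NNPP => no.
pose Bd (w : K * K * K) := [set f : {ffun K -> T} |
  [&& w.2 != w.1.1, w.2 != w.1.2 & f w.2 \in F (f w.1.1) (f w.1.2)]].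
have cBd w : #|Bd w| * #|T| <= #|{: {ffun K -> T}}| * N.
  case: w => [[x y] z]; rewrite -cardsT -cardsX.
  case: (boolP ((z != x) && (z != y))) => [/andP[zx zy]|nz]; last first.
    rewrite (_ : setX _ _ = set0) ?cards0 //; apply/setP=> [[f a]]; rewrite !inE /=.
    by rewrite andbA (negPf nz).
  (* Exchanging [f z] with the extra value turns a bad pair into one whose second entry lies in
     [F (f x) (f y)], hence has at most [N] values per function. The values at [x] and [y] are
     unchanged because both differ from [z]. *)
  pose sw (fa : {ffun K -> T} * T) : {ffun K -> T} * T :=
    ([ffun k => if k == z then fa.2 else fa.1 k], fa.1 z).
  have swK : cancel sw sw.
    case=> f a; rewrite /sw /= ffunE eqxx; congr pair; apply/ffunP=> k; rewrite !ffunE.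
    by case: eqP => // ->.
  rewrite -(card_imset _ (can_inj swK)).
  apply: leq_trans (_ : #|\bigcup_(f : {ffun K -> T}) [set (f, a) | a in F (f x) (f y)]| <= _).
    apply: subset_leq_card; apply/subsetP=> u /imsetP[[f a]]; rewrite !inE /= andbT.
    case/and3P=> _ _ fz ->; apply/bigcupP; exists [ffun k => if k == z then a else f k] => //.
    apply/imsetP; exists (f z) => //.
    by rewrite !ffunE ![_ == z]eq_sym (negPf zx) (negPf zy).
  apply: card_bigcup_le => f _; rewrite card_imset //; by move=> a a' [].
have all : #|{: {ffun K -> T}}| * #|T| <= #|{: K * K * K}| * (#|{: {ffun K -> T}}| * N).
  apply: leq_trans (_ : (\sum_(w : K * K * K) #|Bd w|) * #|T| <= _).
    rewrite leq_mul2r; apply/orP; right; rewrite -cardsT.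
    have -> : [set: {ffun K -> T}] = \bigcup_w Bd w.
      apply/setP=> f; rewrite inE; apply/esym/bigcupP; apply: NNPP => no'; apply: no; exists f.
      move=> x y z zx zy; apply/negP=> bad; apply: no'; exists (x, y, z) => //.
      by rewrite inE /= zx zy.
    elim/big_rec2: _ => [|w S n _ IH]; first by rewrite cards0.
    by rewrite cardsU; lia.
  by rewrite big_distrl /= -sum_nat_const; apply: leq_sum.
have pos : 0 < #|{: {ffun K -> T}}|.
  by rewrite card_ffun expn_gt0; apply/orP; left; apply: leq_trans lt.
move: all; rewrite mulnCA leq_pmul2l // => le.
by move: lt; rewrite ltnNge le.
Qed.

Lemma conn_attach (V J : finType) (e : rel V) (X : {set V}) (D : {pred J}) (R : J -> {set V}) :
  symmetric e -> conn e X -> (forall j, j \in D -> conn e (R j) /\ adjacent e X (R j)) ->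
  conn e (X :|: \bigcup_(j in D) R j).
Proof.
move=> se [[c cX] cc] h; apply: (@conn_star _ _ _ c) => //; first by rewrite inE cX.
set Y := X :|: _.
have sX : X \subset Y by apply: subsetUl.
have toc x : x \in X -> connect (restr e Y) x c by move=> xX; apply: (restr_sub sX); apply: cc.
move=> x /setUP[/toc//|/bigcupP[j jD xR]].
have [[_ cR] [u [v [uX vR uv]]]] := h j jD.
have sR : R j \subset Y by apply: subset_trans (subsetUr _ _); apply: bigcup_sup.
apply: connect_trans (restr_sub sR (cR _ _ xR vR)) _.
apply: connect_trans (toc u uX); apply: connect1.
by rewrite /= (subsetP sR) // (subsetP sX) //= se.
Qed.

(** The stretch between the first visit to [X2] and the last visit to [X1] before it. It is not
    empty because [X1] and [X2] are not adjacent. *)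
Lemma path_between (V : finType) (e : rel V) (X1 X2 Y : {set V}) a p :
  symmetric e -> path e a p -> a \in X1 -> last a p \in X2 -> {subset a :: p <= Y} ->
  [disjoint X1 & X2] -> ~ adjacent e X1 X2 ->
  exists u v, [/\ (exists2 x, x \in X1 & e x u), (exists2 x, x \in X2 & e x v),
    u \in Y :\: (X1 :|: X2), v \in Y :\: (X1 :|: X2) &
    connect (restr e (Y :\: (X1 :|: X2))) u v].
Proof.
move=> se pp aX lX sub dis na; set O := Y :\: _.
have : a \in X1 \/ (a \in O /\ exists u, [/\ exists2 x, x \in X1 & e x u, u \in O &
    connect (restr e O) u a]) by left.
elim: p a {aX} pp lX sub => [|c p IH] a /=.
  move=> _ aX2 _ [aX1|[aO _]]; first by rewrite (disjointFr dis aX1) in aX2.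
  by move: aO; rewrite !inE aX2 orbT.
case/andP=> ac pp lX sub st.
have subc : {subset c :: p <= Y} by move=> x xp; apply: sub; rewrite inE xp orbT.
case: (boolP (c \in X1)) => cX1; first by apply: (IH c) => //; left.
case: (boolP (c \in X2)) => cX2.
  case: st => [aX1|[aO [u [u1 u2 u3]]]]; first by case: na; exists a, c.
  by exists u, a; split=> //; exists c; rewrite // se.
have cO : c \in O by rewrite !inE negb_or cX1 cX2 subc ?mem_head.
apply: (IH c) => //; right; split=> //.
case: st => [aX1|[aO [u [u1 u2 u3]]]]; first by exists c; split; rewrite ?connect0 //; exists a.
exists u; split=> //; apply: connect_trans u3 _; apply: connect1.
by rewrite /= aO cO.
Qed.

(** The segments themselves serve as the family in [crossing], for the linkage of each pair: without
    a grid, all but at most [N0] of them meet fewer than [k] of its paths. [free_set] picks segments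
    none of which is exceptional for a pair of the others. Between two picked segments at most
    [#|K| * k] of the [l] paths are lost to the others, so their neighbourhoods remain [L]-linked
    outside all picked segments, and [disjoint_connections_fin] joins all pairs at once. *)
Lemma segments_grid r : exists t l, forall (V : finType) (e : rel V) (P : 'I_t -> {set V}),
  symmetric e -> (forall i, conn e (P i)) ->
  (forall i j x, x \in P i -> x \in P j -> i = j) ->
  (forall i j, i != j -> lnk e (P i) (P j) l) ->
  minor (@grid_adj r) e.
Proof.
pose K := ('I_r * 'I_r)%type.
have [L conns] := disjoint_connections_fin r (K * K)%type.
have [k cross] := crossing r.
pose l := L + #|{: K}| * k.
have [N0 {}cross] := cross l.
pose t := (#|{: K * K * K}| * N0.+1).+1.
exists t, l => V e P se conP dP lk.
apply: NNPP => ng.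
have links (ij : 'I_t * 'I_t) : exists z : {set 'I_t} * ('I_l -> seq V), #|z.1| <= N0 /\
    (ij.1 != ij.2 -> linkage e (P ij.1) (P ij.2) z.2 /\ forall s, s \notin z.1 -> #|hits z.2 (P s)| < k).
  case: ij => i j /=; case: (eqVneq i j) => [_|ij].
    by exists (set0, fun=> [::]); rewrite cards0.
  have [//|[Q lQ cQ]] := cross V e _ P _ _ se conP dP (lk i j ij).
  exists ([set m | k <= #|hits Q (P m)|], Q); split=> /=; first exact: ltnW.
  by move=> _; split=> // s; rewrite inE -ltnNge.
have [z zP] := fin_all_exists links.
(* Adding [f x] to the forbidden values forces [f] to be injective; this is why the bound is
   [N0.+1]. *)
have [f fP] : exists f : {ffun K -> 'I_t}, forall x y w, w != x -> w != y ->
    f w \notin f x |: (z (f x, f y)).1.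
  apply: (@free_set _ _ (fun a b => a |: (z (a, b)).1) N0.+1) => [a b|].
    rewrite cardsU1; have [h _] := zP (a, b).
    by apply: leq_trans (leq_add (leq_b1 _) h).
  by rewrite card_ord.
have finj x y : f x = f y -> x = y.
  by move=> E; apply/eqP/contraT => ne; have := fP y y x ne ne; rewrite E setU11.
pose X := \bigcup_(w : K) P (f w).
pose e0 := restr e (~: X).
pose nb (x : K) := [set v in ~: X | [exists u in P (f x), e u v]].
(* [path_between] finds a stretch outside both segments only if they are not adjacent; adjacent ones
   are already joined by an edge. *)
pose need (xy : K * K) := (xy.1 != xy.2) &&
  ~~ [exists u in P (f xy.1), exists v in P (f xy.2), e u v].
have se0 : symmetric e0 by apply: restr_sym.
have PX x : P (f x) \subset X by apply: (bigcup_sup x).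
have [xy|mi|[R [R1 R2]]] := conns V e0 need (fun xy => nb xy.1) (fun xy => nb xy.2) se0.
- case: xy => x y /andP[/= xy nadj] S cS.
  have fxy : f x != f y by apply: contraNneq xy => /finj->.
  have [_ /(_ fxy)[/= lQ few]] := zP (f x, f y).
  set Q := (z (f x, f y)).2 in lQ few; set Fb := (z (f x, f y)).1 in few.
  pose oth := [set w : K | (w != x) && (w != y)].
  have [j jn] : exists j, j \notin hits Q S :|: \bigcup_(w in oth) hits Q (P (f w)).
    apply: NNPP => no.
    have le1 : #|\bigcup_(w in oth) hits Q (P (f w))| <= #|oth| * k.
      apply: card_bigcup_le => w; rewrite inE => /andP[wx wy]; apply: ltnW; apply: few.
      by have := fP x y w wx wy; rewrite !inE negb_or => /andP[].
    have le2 : #|oth| * k <= #|{: K}| * k by rewrite leq_mul2r max_card orbT.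
    have : #|'I_l| <= #|hits Q S :|: \bigcup_(w in oth) hits Q (P (f w))|.
      apply: subset_leq_card; apply/subsetP=> j _; apply: contraT => jn.
      by case: no; exists j.
    apply/negP; rewrite card_ord -ltnNge cardsU; apply: leq_ltn_trans (leq_subr _ _) _.
    rewrite -addSn; apply: leq_add (leq_trans le1 le2).
    exact: leq_ltn_trans (card_hits S lQ) cS.
  move: jn; rewrite in_setU negb_or => /andP[jS jo].
  have [hQ _ _] := lQ; have [a [p [E pp aA lB]]] := hQ j.
  pose Y := ~: (S :|: \bigcup_(w in oth) P (f w)).
  have sub : {subset a :: p <= Y}.
    rewrite -E => v vQ; rewrite in_setC in_setU negb_or (notin_hits jS vQ).
    apply/bigcupP=> [[w wo vP]]; move/negP: jo; apply; apply/bigcupP; exists w => //.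
    by rewrite inE; apply/existsP; exists v; rewrite vP.
  have dis : [disjoint P (f x) & P (f y)].
    rewrite -setI_eq0; apply/eqP/setP=> v; rewrite in_setI in_set0; apply: contraNF fxy.
    by case/andP=> h1 h2; rewrite (dP _ _ _ h1 h2).
  have na : ~ adjacent e (P (f x)) (P (f y)).
    case=> u [v [uP vP uv]]; move/negP: nadj; apply; apply/existsP; exists u; rewrite uP.
    by apply/existsP; exists v; rewrite vP.
  have [u [v [[u' u'P u'u] [v' v'P v'v] uO vO uv]]] := path_between se pp aA lB sub dis na.
  have OX : Y :\: (P (f x) :|: P (f y)) \subset ~: X :\: S.
    apply/subsetP=> q; rewrite in_setD in_setU negb_or => /andP[/andP[qx qy]].
    rewrite in_setC in_setU negb_or => /andP[qS qo]; rewrite in_setD qS in_setC.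
    apply/bigcupP=> [[w _ qw]]; move/negP: qo; apply; apply/bigcupP; exists w => //.
    rewrite inE; apply/andP; split; first by apply: contraNneq qx => <-.
    by apply: contraNneq qy => <-.
  have /setDP[uX uS] := subsetP OX _ uO; have /setDP[vX vS] := subsetP OX _ vO.
  exists u, v; split.
  + by rewrite in_setD uS inE uX; apply/existsP; exists u'; rewrite u'P.
  + by rewrite in_setD vS inE vX; apply/existsP; exists v'; rewrite v'P.
  apply: connect_sub uv => q q' /and3P[/(subsetP OX)/setDP[qX qS] /(subsetP OX)/setDP[q'X q'S] qq'].
  by apply: connect1; rewrite /e0 /= !in_setC in qX q'X *; rewrite qS q'S qX q'X.
- by apply: ng; apply: minor_sub mi => u v /and3P[].
have RX xy v : need xy -> v \in R xy -> v \notin X.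
  move=> nxy vR; have [cR [a aR]] := R1 xy nxy; rewrite inE => /andP[aX _] _.
  by have := subsetP (conn_restr_sub cR aR aX) v vR; rewrite inE.
apply: ng; exists (fun x => P (f x) :|: \bigcup_(y in [pred y | need (x, y)]) R (x, y)); split.
- move=> x; apply: conn_attach => // y; rewrite inE => nxy.
  have [cR [a aR]] := R1 _ nxy; rewrite inE => /andP[_ /existsP[u /andP[uP ua]]] _.
  by split; [apply: conn_sub cR => ? ? _ _ /and3P[] | exists u, a].
- move=> x x' xx'; rewrite -setI_eq0; apply/eqP/setP=> v; rewrite in_setI in_set0.
  apply: contraNF xx' => /andP[/setUP[vP|/bigcupP[y nxy vR]] /setUP[vP'|/bigcupP[y' nxy' vR']]].
  + by rewrite (finj _ _ (dP _ _ _ vP vP')).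
  + by have := RX _ _ nxy' vR'; rewrite (subsetP (PX x)).
  + by have := RX _ _ nxy vR; rewrite (subsetP (PX x')).
  + by have [-> _] := R2 _ _ _ nxy nxy' vR vR'.
- move=> x y xy; have ne := grid_adj_neq xy.
  case: (boolP (need (x, y))) => [nxy|]; last first.
    rewrite /need ne /= negbK => /existsP[u /andP[uP /existsP[v /andP[vP uv]]]].
    by exists u, v; rewrite !inE uP vP.
  have [_ _ [b bR]] := R1 _ nxy; rewrite inE => /andP[_ /existsP[u /andP[uP ub]]].
  exists b, u; split; last by rewrite se.
    by rewrite inE; apply/orP; right; apply/bigcupP; exists y.
  by rewrite inE uP.
Qed.

(** * The excluded grid theorem *)

Section Bramble.
Variables (V : finType) (e : rel V).
Hypothesis se : symmetric e.

Lemma path_to_first (K : {set V}) u q : path e u q -> uniq (u :: q) ->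
  last u q \in K -> u \notin K ->
  exists q', [/\ path e u q', uniq (u :: q'), {subset q' <= q}, last u q' \in K &
    forall v, v \in u :: q' -> v \in K -> v = last u q'].
Proof.
elim: q u => [|c q IH] u /=; first by move=> _ _ ->.
case/andP=> uc pp /andP[uq uq'] lK uK.
have [cK|cK] := boolP (c \in K).
  exists [:: c]; rewrite /= uc cK; split=> //.
  - by rewrite inE; move: uq; rewrite inE negb_or => /andP[->].
  - by move=> v; rewrite !inE => /eqP->; rewrite eqxx.
  - by move=> v; rewrite !inE => /orP[/eqP->|/eqP-> //]; rewrite (negPf uK).
have [q' [h1 h2 h3 h4 h5]] := IH c pp uq' lK cK.
have sub : {subset c :: q' <= c :: q}.
  by move=> v; rewrite !inE => /orP[->//|/h3->]; rewrite orbT.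
exists (c :: q'); rewrite /= uc h1; split=> //.
  by rewrite -[(c \notin q') && _]/(uniq (c :: q')) h2 andbT; apply: contra uq => /sub.
by move=> v; rewrite inE => /orP[/eqP->|]; [rewrite (negPf uK) | apply: h5].
Qed.

Variable F : {set V} -> Prop.
Hypothesis Fconn : forall K, F K -> conn e K.
Hypothesis Fmeet : forall K K', F K -> F K' -> meets K K'.

(** The invariant is that the path ends in a member [K] that it meets nowhere else. If a member [K']
    is missed, [K] meets [K'], so the path can be prolonged inside [K] up to the first vertex of
    [K'] and stays simple; its length bounds the number of rounds. *)
Lemma path_through_bramble : (exists K, F K) ->
  exists x p, [/\ path e x p, uniq (x :: p) & forall K, F K -> exists2 v, v \in x :: p & v \in K].
Proof.
case=> K0 FK0; have [[x0 xK0] _] := Fconn FK0.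
pose c := #|V|.
suff main n (x : V) (p : seq V) (K : {set V}) : c - size p < n -> F K -> path e x p -> uniq (x :: p) ->
    last x p \in K -> (forall v, v \in x :: p -> v \in K -> v = last x p) ->
    exists x p, [/\ path e x p, uniq (x :: p) & forall K, F K -> exists2 v, v \in x :: p & v \in K].
  apply: (main _ x0 [::] K0 (ltnSn _)) => //= v; by rewrite inE => /eqP.
elim: n x p K {K0 FK0 x0 xK0} => // n IH x p K sz FK pp up lK only.
case: (classic (exists K', F K' /\ forall v, v \in x :: p -> v \notin K')); last first.
  move=> no; exists x, p; split=> // K' FK'; apply: NNPP => no'; apply: no; exists K'; split=> //.
  by move=> v vp; apply/negP=> vK; apply: no'; exists v.
case=> K' [FK' out]; have [b cK cK'] := Fmeet FK FK'.
have [_ /(_ _ _ lK cK)/connectP[q0 pq0 lq0]] := Fconn FK.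
case/shortenP: pq0 lq0 => q pq uq _ lq.
have lK' : last x p \notin K' by apply: out; apply: mem_last.
rewrite lq in cK'.
have [q' [h1 h2 h3 h4 h5]] := path_to_first (restr_pathW pq) uq cK' lK'.
have q'K : {subset q' <= K} by move=> v /h3/(restr_path_mem pq).
have q'p v : v \in q' -> v \notin x :: p.
  move=> vq; apply/negP=> vp; have E := only v vp (q'K _ vq).
  by move: h2; rewrite /= -E vq.
have uq' : uniq q' by case/andP: h2.
have ucat : uniq ((x :: p) ++ q').
  by rewrite cat_uniq up uq' andbT; apply/hasPn.
have szV : size (x :: p ++ q') <= c.
  by rewrite -(card_uniqP ucat) max_card.
apply: (IH x (p ++ q') K') => //.
- rewrite size_cat; case: q' h4 {h1 h2 h3 h5 q'K q'p uq' ucat} szV => [|c' q'] /=; first by rewrite (negPf lK').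
  by rewrite size_cat /= => _ szV; lia.
- by rewrite cat_path pp.
- by rewrite last_cat.
move=> v; rewrite -cat_cons mem_cat last_cat => /orP[/out/negPf-> //|vq].
by apply: h5; rewrite inE vq orbT.
Qed.

End Bramble.

(** The first segment is the shortest prefix such that fewer than [l] vertices cannot hit all
    members touching it. By minimality some [S0] with fewer than [l] vertices hits all members
    touching the prefix without its last vertex [y], and [y |: S0] serves for the whole prefix. So
    only [l] is lost from the order: the members disjoint from the prefix still cannot be hit by
    fewer than [t * l] vertices. *)
Lemma split_path (V : finType) (e : rel V) l t : symmetric e -> 0 < l ->
  forall (F : {set V} -> Prop) (s : seq V), sorted e s -> uniq s ->
  (forall K, F K -> exists2 v, v \in s & v \in K) ->
  (forall S : {set V}, #|S| < t * l -> exists2 K, F K & [disjoint K & S]) ->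
  exists P : nat -> {set V},
    [/\ forall i, i < t -> conn e (P i) /\ {subset P i <= s},
        forall i j x, i < t -> j < t -> x \in P i -> x \in P j -> i = j &
        forall i (S : {set V}), i < t -> #|S| < l ->
          exists K, [/\ F K, [disjoint K & S] & meets K (P i)]].
Proof.
move=> se l0; elim: t => [|t IH] F s srt us hit ord; first by exists (fun=> set0).
pose pre a := [set x in take a s].
pose Ord a := forall S : {set V}, #|S| < l -> exists K, [/\ F K, [disjoint K & S] & meets K (pre a)].
have OrdS : Ord (size s).
  move=> S cS; have [|K FK dK] := ord S; first by rewrite mulSn; apply: leq_trans cS (leq_addr _ _).
  by have [v vs vK] := hit K FK; exists K; split=> //; exists v; rewrite // inE take_size.
have [a [Oa mina]] := ex_min id (ex_intro _ _ OrdS).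
have asz : a <= size s := mina _ OrdS.
have a0 : 0 < a.
  case: (posnP a) => // a0; have [K [_ _ [v _]]] := Oa set0 ltac:(by rewrite cards0).
  by rewrite a0 inE take0.
have [S0 [cS0 hS0]] : exists S0 : {set V}, #|S0| < l /\
    forall K, F K -> [disjoint K & S0] -> ~ meets K (pre a.-1).
  apply: NNPP => no; have : a <= a.-1; last by lia.
  apply: mina => S cS; apply: NNPP => no'; apply: no; exists S; split=> // K FK dK mK.
  by apply: no'; exists K.
have [d _] : exists x, x \in s by case: (s) asz => [|x s']; [case: (a) a0 | exists x; rewrite mem_head].
pose y := nth d s a.-1.
have preE x : x \in pre a -> x = y \/ x \in pre a.-1.
  have lt1 : a.-1 < size s by rewrite prednK.
  rewrite !inE -{1}(prednK a0) (take_nth d lt1) mem_rcons.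
  by rewrite inE => /orP[/eqP->|]; [left | right].
pose F' K := F K /\ [disjoint K & pre a].
have [||||P [P1 P2 P3]] := IH F' (drop a s).
- exact: drop_sorted.
- exact: drop_uniq.
- move=> K [FK dK]; have [v vs vK] := hit K FK; exists v => //.
  move: vs; rewrite -{1}(cat_take_drop a s) mem_cat => /orP[vt|//].
  by have := disjointFr dK vK; rewrite inE vt.
- move=> S cS; have [|K FK dK] := ord (y |: (S0 :|: S)).
    rewrite cardsU1 cardsU mulSn; lia.
  exists K; last by apply: disjointWr dK; rewrite setUA subsetUr.
  split=> //; rewrite -setI_eq0; apply/eqP/setP=> v; rewrite in_setI in_set0.
  apply/negP=> /andP[vK /preE[E|vp]].
    by have := disjointFr dK vK; rewrite E setU11.
  apply: (hS0 K FK); last by exists v.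
  by apply: disjointWr dK; apply/subsetP=> w wS; rewrite !inE wS orbT.
have us' : uniq (take a s ++ drop a s) by rewrite cat_take_drop.
have dis x i : i < t -> x \in pre a -> x \in P i -> False.
  rewrite inE => it xt xP; have [_ /(_ _ xP) xd] := P1 i it.
  by move: us'; rewrite cat_uniq => /and3P[_ /hasPn/(_ _ xd)]; rewrite /= xt.
exists (fun i => if i is i'.+1 then P i' else pre a); split.
- case=> [_|i it]; last first.
    by have [h1 h2] := P1 i it; split=> // x /h2/mem_drop.
  split; last by move=> x; rewrite inE => /mem_take.
  have := take_sorted a srt; rewrite /pre; case E : (take a s) => [|x p] /=.
    by have := congr1 size E; rewrite size_take /=; case: ltnP; lia.
  exact: conn_path.
- case=> [|i] [|j] x it jt //; first by move=> /(dis _ _ jt) h /h.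
    by move=> h1 /(dis _ _ it)/(_ h1).
  by move=> h1 h2; congr _.+1; apply: P2 h1 h2.
- case=> [|i] S it cS; first exact: Oa.
  by have [K [[FK _] dK mK]] := P3 i S it cS; exists K.
Qed.

(** Two segments are linked because, for a small [S], each is touched by a member avoiding [S], and
    these two members meet. *)
Lemma bramble_grid r : exists k, forall (V : finType) (e : rel V) (W : {set V}),
  symmetric e ->
  (forall S : {set V}, #|S| <= k ->
     exists K, [/\ conn e K, [disjoint K & S] & #|W| < 2 * #|K :&: W|]) ->
  minor (@grid_adj r) e.
Proof.
(* [split_path] asks for a positive order, whence [l.+1]. *)
have [t [l seg]] := segments_grid r; exists (t * l.+1) => V e W se big.
pose F K := conn e K /\ #|W| < 2 * #|K :&: W|.
have Fmeet K K' : F K -> F K' -> meets K K'.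
  move=> [_ h] [_ h']; apply: NNPP => no.
  have d0 : (K :&: W) :&: (K' :&: W) = set0.
    apply/setP=> x; rewrite !inE; apply/negP=> /andP[/andP[xK _] /andP[xK' _]].
    by apply: no; exists x.
  have : #|(K :&: W) :|: (K' :&: W)| <= #|W|.
    by apply: subset_leq_card; rewrite subUset !subsetIr.
  by rewrite cardsU d0 cards0; lia.
have [|x [p [pp up hit]]] := @path_through_bramble _ e F (fun K h => proj1 h) Fmeet.
  by have [|K [h1 _ h3]] := big set0; [rewrite cards0 | exists K].
have ord (S : {set V}) : #|S| < t * l.+1 -> exists2 K, F K & [disjoint K & S].
  by move=> /ltnW/big[K [h1 h2 h3]]; exists K.
have [P [P1 P2 P3]] := @split_path _ e l.+1 t se isT F (x :: p) pp up hit ord.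
apply: (seg V e (fun i => P i)) => //.
- by move=> i; have [] := P1 i (ltn_ord i).
- by move=> i j v h1 h2; apply: val_inj; apply: P2 h1 h2.
move=> i j _ S cS.
have [K [FK dK [a aK aP]]] := P3 i S (ltn_ord i) (ltnW cS).
have [K' [FK' dK' [b bK bP]]] := P3 j S (ltn_ord j) (ltnW cS).
have [c cK cK'] := Fmeet _ _ FK FK'.
have sub (Z : {set V}) : [disjoint Z & S] -> Z \subset ~: S.
  by move=> dZ; apply/subsetP=> v vZ; rewrite inE (disjointFr dZ vZ).
exists a, b; rewrite !in_setD aP bP (disjointFr dK aK) (disjointFr dK' bK); split=> //.
have [[_ cK1] _] := FK; have [[_ cK1'] _] := FK'.
by apply: (connect_trans (restr_sub (sub _ dK) (cK1 _ _ aK cK)));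
   apply: (restr_sub (sub _ dK') (cK1' _ _ cK' bK)).
Qed.

(** * Tree decompositions from balanced separators *)

Definition comp (V : finType) (e : rel V) (S : {set V}) (x : V) : {set V} :=
  [set y | connect (restr e (~: S)) x y].

Lemma comp_trans (V : finType) (e : rel V) (S : {set V}) x y z :
  y \in comp e S x -> connect (restr e (~: S)) y z -> z \in comp e S x.
Proof. by rewrite !inE; apply: connect_trans. Qed.

Definition nbh (V : finType) (e : rel V) (X C : {set V}) : {set V} :=
  [set y in X | [exists z in C, e z y]].

(* Node [i > 0] hangs below node [par i]; the bags containing a vertex form a
   subtree because each of them but one has its parent among them. *)
Definition rooted_dec (V : finType) (e : rel V) (X : {set V}) (w N : nat)
    (par : nat -> nat) (bag : nat -> {set V}) : Prop :=
  [/\ forall i, 0 < i <= N -> par i < i,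
      forall i, i <= N -> bag i \subset X /\ #|bag i| <= w,
      forall x, x \in X -> exists2 t, (t <= N) && (x \in bag t) &
        forall i, i <= N -> x \in bag i -> i = t \/ (0 < i /\ x \in bag (par i)) &
      forall x y, x \in X -> y \in X -> e x y -> exists2 i, i <= N & (x \in bag i) && (y \in bag i)].

(** [X] is the part decomposed so far; each component of the rest has at most [2 * k + 2] neighbours
    in [X], all in one bag. Below that bag hangs a new one, made of these neighbours [W], a vertex
    [x] of the component and the part of a balanced separator [S] inside it: at most
    [2 * k + 2 + k + 1] vertices. A remaining component sees at most half of [W], that is [k + 1]
    vertices, and at most [k + 1] vertices of [x |: S], so the bound persists. *)
Lemma grow_dec (V : finType) (e : rel V) k : symmetric e ->
  (forall W : {set V}, #|W| <= 2 * k + 2 ->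
     exists S : {set V}, #|S| <= k /\
       forall y, y \notin S -> 2 * #|comp e S y :&: W| <= #|W|) ->
  exists N par bag, rooted_dec e setT (3 * k + 3) N par bag.
Proof.
move=> se bal.
suff main n (X : {set V}) N par bag : #|~: X| < n -> rooted_dec e X (3 * k + 3) N par bag ->
    (forall x, x \notin X -> #|nbh e X (comp e X x)| <= 2 * k + 2 /\
       exists2 i, i <= N & nbh e X (comp e X x) \subset bag i) ->
    exists N par bag, rooted_dec e setT (3 * k + 3) N par bag.
  apply: (main _ set0 0 (fun=> 0) (fun=> set0) (ltnSn _)).
    split=> [i|i _|x|x y]; rewrite ?inE //; first by lia.
    by rewrite sub0set cards0.
  move=> x _; have -> : nbh e set0 (comp e set0 x) = set0 by apply/setP=> y; rewrite !inE.
  by rewrite cards0; split=> //; exists 0.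
elim: n X N par bag => // n IH X N par bag cX dec cmp.
case: (pickP [pred x | x \notin X]) => [x /= xX|all]; last first.
  exists N, par, bag; rewrite (_ : setT = X) //; apply/setP=> x.
  by rewrite inE; have /negbFE-> := all x.
have [dpar dbag dtop dedge] := dec.
have [cW [i0 i0N sW]] := cmp x xX.
set C := comp e X x in cW sW; set W := nbh e X C in cW sW.
have [S [cS balS]] := bal W cW.
(* Including [x] guarantees progress even when [S] misses [C]. *)
pose Nw := x |: (S :&: C); pose X' := X :|: Nw.
have CX v : v \in C -> v \notin X.
  by rewrite inE => /connect_restr_mem; rewrite !inE; apply.
have xC : x \in C by rewrite inE connect0.
have NwC : Nw \subset C by rewrite subUset sub1set xC subsetIr.
have Cclosed u v : u \in C -> e u v -> v \notin X -> v \in C.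
  move=> uC uv vX; apply: (comp_trans uC).
  by apply: connect1; rewrite /= !in_setC vX CX.
have inW u v : u \in X -> v \in C -> e v u -> u \in W.
  by move=> uX vC vu; rewrite inE uX; apply/existsP; exists v; rewrite vC.
have cNw : #|Nw| <= k.+1.
  by rewrite cardsU1; have := subset_leq_card (subsetIl S C); lia.
pose par' i := if i == N.+1 then i0 else par i.
pose bag' i := if i == N.+1 then W :|: Nw else bag i.
have oldp i : i <= N -> par' i = par i by rewrite /par'; case: eqP => // ->; lia.
have oldb i : i <= N -> bag' i = bag i by rewrite /bag'; case: eqP => // ->; lia.
have newp : par' N.+1 = i0 by rewrite /par' eqxx.
have newb : bag' N.+1 = W :|: Nw by rewrite /bag' eqxx.
have WX : W \subset X by apply/subsetP=> v; rewrite inE => /andP[].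
have split_le i : i <= N.+1 -> i = N.+1 \/ i <= N by lia.
have NwX v : v \in Nw -> v \notin X by move=> /(subsetP NwC)/CX.
apply: (IH X' N.+1 par' bag').
- apply: leq_trans (_ : #|~: X| <= n); last by rewrite -ltnS.
  apply: proper_card; apply/properP; split; first by rewrite setCS subsetUl.
  by exists x; rewrite !inE // ?eqxx ?orbT // (negPf xX).
- split.
  + move=> i /andP[i1 /split_le[->|iN]]; first by rewrite newp ltnS.
    by rewrite oldp //; apply: dpar; rewrite i1.
  + move=> i /split_le[->|iN].
      rewrite newb setSU //; split=> //; rewrite cardsU; lia.
    by rewrite oldb //; have [h1 h2] := dbag i iN; split=> //; apply: subset_trans h1 (subsetUl _ _).
  + move=> v /setUP[vX|vN].
      have [t /andP[tN vt] top] := dtop v vX; exists t; first by rewrite leqW // oldb.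
      move=> i /split_le[->|iN].
        rewrite newb newp => /setUP[vW|/NwX]; last by rewrite vX.
        by right; split=> //; rewrite oldb // (subsetP sW).
      rewrite oldb // oldp // => vi; case: (top i iN vi) => [|[i1 vp]]; [by left | right].
      by split=> //; rewrite oldb //; apply: (leq_trans _ iN); apply/ltnW/dpar; rewrite i1.
    exists N.+1; first by rewrite leqnn newb inE vN orbT.
    move=> i /split_le[->|iN]; first by left.
    by rewrite oldb // => vb; have [/subsetP/(_ _ vb)] := dbag i iN; rewrite (negPf (NwX _ vN)).
  + move=> u v uX' vX' uv; case/setUP: (uX') (vX') => [uX|uN] /setUP[vX|vN].
    * have [i iN iuv] := dedge u v uX vX uv; exists i; first exact: leqW.
      by rewrite oldb.
    * exists N.+1; rewrite // newb; apply/andP; split; apply/setUP; [left|by right].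
      by apply: (inW u v); rewrite // ?(subsetP NwC) // se.
    * exists N.+1; rewrite // newb; apply/andP; split; apply/setUP; [by right|left].
      by apply: (inW v u); rewrite // (subsetP NwC).
    * by exists N.+1; rewrite // newb; apply/andP; split; apply/setUP; right.
move=> y yX'; have /norP[yX yN] : ~~ ((y \in X) || (y \in Nw)) by rewrite -in_setU.
set C' := comp e X' y.
have subD : C' \subset comp e X y.
  apply/subsetP=> v; rewrite !inE; apply: restr_sub; by rewrite setCS subsetUl.
have C'X' v : v \in C' -> v \notin X'.
  by rewrite inE => /connect_restr_mem; rewrite !in_setC; apply.
case: (boolP (y \in C)) => yC.
  have C'C : C' \subset C.
    apply: subset_trans subD _; apply/subsetP=> v; rewrite inE => yv.
    exact: comp_trans yC yv.
  have sub1 : nbh e X' C' \subset W :|: Nw.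
    apply/subsetP=> u; rewrite inE => /andP[/setUP[uX|uN] /existsP[z /andP[zC zu]]].
      by rewrite inE (inW u z) // (subsetP C'C).
    by rewrite inE uN orbT.
  split; last by exists N.+1; rewrite ?leqnn ?newb.
  have yS : y \notin S by apply: contra yN => yS; rewrite !inE yS; move: yC; rewrite inE => ->; rewrite orbT.
  have C'S v : v \in C' -> v \notin S.
    move=> vC; apply/negP=> vS; have := C'X' v vC.
    by rewrite in_setU negb_or in_setU1 negb_or in_setI vS (subsetP C'C) // !andbF.
  have C'K : C' \subset comp e S y.
    have key p z : z \in C' -> path (restr e (~: X')) z p -> connect (restr e (~: S)) z (last z p).
      elim: p z => //= q p IHp z zC /andP[zq pp].
      have qC : q \in C' by apply: (comp_trans zC); apply: connect1.
      apply: connect_trans (IHp q qC pp); apply: connect1.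
      by case/and3P: zq => _ _ zq; rewrite /= !in_setC !C'S.
    apply/subsetP=> v; rewrite inE => /connectP[p pp ->]; rewrite inE; apply: key => //.
    by rewrite inE connect0.
  have : nbh e X' C' \subset (comp e S y :&: W) :|: (x |: S).
    apply/subsetP=> u uN; case: (boolP (u \in x |: S)) => uxS; first by rewrite inE uxS orbT.
    rewrite in_setU in_setI; have := subsetP sub1 u uN; rewrite in_setU.
    have -> /= : (u \in Nw) = false.
      by apply: contraNF uxS; rewrite !inE => /orP[->//|/andP[->]]; rewrite orbT.
    rewrite orbF => ->; rewrite andbT.
    have [uS] : u \notin S /\ True by move: uxS; rewrite !inE negb_or => /andP[].
    move: uN; rewrite inE => /andP[_ /existsP[z /andP[zC zu]]] _.
    have := subsetP C'K z zC; rewrite !inE => yz; rewrite (connect_trans yz) //.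
    by apply: connect1; rewrite /= !in_setC uS C'S.
  move=> /subset_leq_card h; apply: leq_trans h _.
  rewrite cardsU; apply: leq_trans (leq_subr _ _) _.
  apply: leq_trans (_ : #|comp e S y :&: W| + k.+1 <= _).
    by rewrite leq_add2l cardsU1; apply: leq_add (leq_b1 _) cS.
  by move: (balS y yS) cW; move: #|_ :&: _| #|W|; clear; lia.
have sub2 : nbh e X' C' \subset nbh e X (comp e X y).
  apply/subsetP=> u; rewrite inE => /andP[/setUP[uX|uN] /existsP[z /andP[zC zu]]].
    by rewrite inE uX; apply/existsP; exists z; rewrite (subsetP subD).
  case/negP: yC; have uC := subsetP NwC _ uN.
  have zX : z \notin X by have := C'X' z zC; rewrite in_setU negb_or => /andP[].
  have zCC : z \in C by apply: (Cclosed u) => //; rewrite se.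
  have := subsetP subD z zC; rewrite inE (sym_connect_sym (restr_sym _ se)) => zy.
  exact: comp_trans zCC zy.
have [h1 [i iN h2]] := cmp y yX; split; first exact: leq_trans (subset_leq_card sub2) h1.
by exists i; [apply: leqW | rewrite oldb //; apply: subset_trans sub2 h2].
Qed.

Theorem excluded_grid r : exists w, forall (V : finType) (e : rel V), symmetric e ->
  minor (@grid_adj r) e \/ exists N par bag, rooted_dec e setT w N par bag.
Proof.
have [k bg] := bramble_grid r; exists (3 * k + 3) => V e se.
case: (classic (forall W : {set V}, #|W| <= 2 * k + 2 ->
     exists S : {set V}, #|S| <= k /\
       forall y, y \notin S -> 2 * #|comp e S y :&: W| <= #|W|)) => [bal|nb].
  by right; apply: grow_dec.
left; have [W {}nb] := not_all_ex_not _ _ nb; have [_ {}nb] := imply_to_and _ _ nb.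
apply: (bg V e W se) => S cS; apply: NNPP => no; apply: nb; exists S; split=> // y yS.
rewrite leqNgt; apply/negP=> lt; apply: no; exists (comp e S y).
have mem z : z \in comp e S y -> z \notin S.
  by rewrite inE => /connect_restr_mem; rewrite !inE; apply.
split=> //; last first.
  rewrite -setI_eq0; apply/eqP/setP=> z; rewrite in_setI in_set0; apply/negP=> /andP[/mem/negP].
  by [].
have key p z : z \in comp e S y -> path (restr e (~: S)) z p ->
    connect (restr e (comp e S y)) z (last z p).
  elim: p z => //= q p IHp z zC /andP[zq pp].
  have qC : q \in comp e S y by apply: (comp_trans zC); apply: connect1.
  apply: connect_trans (IHp q qC pp); apply: connect1.
  by case/and3P: zq => _ _ zq; apply/and3P.
have yC : y \in comp e S y by rewrite inE connect0.
apply: (@conn_star _ _ _ y) => // z; rewrite inE => /connectP[p pp ->].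
by rewrite (sym_connect_sym (restr_sym _ se)); apply: key.
Qed.

(** * Generalized hypertree width *)

Section RootedTree.
Variables (N : nat) (par : nat -> nat).
Hypothesis parP : forall i, 0 < i <= N -> par i < i.

Definition tree_rel : rel 'I_N.+1 :=
  fun i j => ((0 < j) && (par j == i)) || ((0 < i) && (par i == j)).

Lemma tree_rel_sym : symmetric tree_rel.
Proof. by move=> i j; rewrite /tree_rel orbC. Qed.

Lemma tree_rel_par (i : 'I_N.+1) : 0 < i -> exists2 j : 'I_N.+1, par i = j & tree_rel i j.
Proof.
move=> i0; have iN := ltn_ord i; have lt : par i < i by apply: parP; rewrite i0.
have lt' : par i < N.+1 by apply: ltn_trans iN.
by exists (Ordinal lt'); rewrite // /tree_rel i0 eqxx orbT.
Qed.

Lemma tree_rel_lt (i j : 'I_N.+1) : tree_rel i j -> j <= i -> par i = j.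
Proof.
case/orP=> /andP[p0 /eqP E] // ji; have jN := ltn_ord j.
by have : par j < j by [apply: parP; lia]; lia.
Qed.

(** On a cycle, both neighbours of the node with the largest number would be its parent, hence
    equal. *)
Lemma tree_rel_tree : is_tree tree_rel.
Proof.
split.
- exact: tree_rel_sym.
- move=> i; apply/negP=> h; have E := tree_rel_lt h (leqnn i).
  case/orP: h => /andP[i0 _]; have := parP (i := i); have := ltn_ord i; lia.
- exact: (inhabits ord0).
- have to0 (i : 'I_N.+1) : connect tree_rel i ord0.
    case: i => i; elim/ltn_ind: i => i IH iN.
    case: (posnP i) => [i0|i0].
      by rewrite (_ : Ordinal iN = ord0) //; apply: val_inj.
    have [j E r] := @tree_rel_par (Ordinal iN) i0; apply: connect_trans (connect1 r) _.
    case: j E r => j jN /= E _; apply: IH; rewrite -E; apply: parP; lia.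
  move=> x y; apply: connect_trans (to0 x) _.
  by rewrite (sym_connect_sym tree_rel_sym).
case=> x [p /and4P[szp up pp lx]].
have cyc : cycle tree_rel (x :: p) by rewrite /= rcons_path pp.
have [m mp mx] : exists2 m, m \in x :: p & forall v, v \in x :: p -> (v <= m)%N.
  have [m mP mx] := @arg_maxnP _ x [pred v | v \in x :: p] (fun v => val v) (mem_head _ _).
  by exists m.
have [i q E] := rot_to mp.
have uq : uniq (m :: q) by rewrite -E rot_uniq.
have cq : cycle tree_rel (m :: q) by rewrite -E rot_cycle.
have szq : size q = size p by have := congr1 size E; rewrite size_rot /= => -[].
have le v : v \in m :: q -> v <= m by rewrite -E mem_rot; apply: mx.
case: q E uq cq szq le => [|a q] E; first by case: (p) szp.
rewrite /= rcons_path => /andP[mq /andP[aq _]] /andP[ma /andP[_ lm]] szq le.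
have ain : a \in m :: a :: q by rewrite !inE eqxx orbT.
have Ea := tree_rel_lt ma (le _ ain).
rewrite tree_rel_sym in lm.
have lin : last a q \in m :: a :: q by rewrite inE mem_last orbT.
have El := tree_rel_lt lm (le _ lin).
have /val_inj Eal : val a = val (last a q) by rewrite /= -Ea -El.
case: q Eal aq szq {E mq lm lin ain El le} => [|b q] Eal aq szq.
  by move: szp; rewrite -szq.
by move: aq; rewrite {1}Eal /= mem_last.
Qed.

End RootedTree.

(** The intersection graph of the edges, as a relation on all sets of vertices: a set that is not an
    edge is an isolated vertex. *)
Definition edge_adj (T : finType) (H : hypergraph T) : rel {set T} :=
  restr (fun a b => (a != b) && (a :&: b != set0)) (hE H).

Lemma edge_adj_sym (T : finType) (H : hypergraph T) : symmetric (edge_adj H).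
Proof. by apply: restr_sym => a b; rewrite eq_sym setIC. Qed.

(** A bag of edges is replaced by their union, which these edges cover. The nodes whose bag contains
    a given edge form a subtree, and two edges through the same vertex are adjacent, so their
    subtrees share a node. *)
Lemma rooted_dec_ghw (T : finType) (H : hypergraph T) w N par bag :
  rooted_dec (edge_adj H) setT w N par bag -> ghw_le H w.
Proof.
move=> [dpar dbag dtop dedge].
pose X (u : 'I_N.+1) := bag u :&: hE H.
exists 'I_N.+1, (@tree_rel N par), (fun u => \bigcup_(a in X u) a); split; last first.
  move=> u; exists (X u); split=> //; first exact: subsetIr.
  have [_ h] := dbag u (ltn_ord u); apply: leq_trans h; apply: subset_leq_card.
  exact: subsetIl.
have conn1 (a : {set T}) (v : T) (u1 u2 : 'I_N.+1) : v \in a -> a \in X u1 -> a \in X u2 ->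
    connect [rel b c | [&& tree_rel par b c, v \in \bigcup_(a in X b) a & v \in \bigcup_(a in X c) a]] u1 u2.
  move=> va; set R := [rel b c | _].
  have sR : symmetric R by move=> b c; rewrite /R /= tree_rel_sym; congr (_ && _); rewrite andbC.
  have [t /andP[tN ta] top] := dtop a (in_setT a).
  have tN' : t < N.+1 by [].
  have vX (u : 'I_N.+1) : a \in X u -> v \in \bigcup_(a in X u) a.
    by move=> aX; apply/bigcupP; exists a.
  have toT (u : 'I_N.+1) : a \in X u -> connect R u (Ordinal tN').
    case: u => u; elim/ltn_ind: u => u IH uN aX.
    have au : a \in bag u by move: aX; rewrite inE => /andP[].
    have aH : a \in hE H by move: aX; rewrite inE => /andP[].
    case: (top u uN au) => [E|[u0 ap]].
      by rewrite (_ : Ordinal uN = Ordinal tN') //; apply: val_inj.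
    have [j E r] := @tree_rel_par N par dpar (Ordinal uN) u0.
    have aj : a \in X j by rewrite inE aH andbT -E.
    apply: connect_trans (_ : connect R _ j) _.
      by apply: connect1; rewrite /R /= r !vX.
    case: j E aj {r} => j jN /= E aj; apply: IH => //; rewrite -E.
    by apply: dpar; rewrite u0.
  move=> h1 h2; apply: connect_trans (toT _ h1) _.
  by rewrite (sym_connect_sym sR); apply: toT.
split.
- exact: tree_rel_tree.
- move=> a aH; have [t /andP[tN ta] _] := dtop a (in_setT a).
  have tN' : t < N.+1 by [].
  by exists (Ordinal tN'); apply: bigcup_sup; rewrite inE ta.
move=> v _ u1 u2 /bigcupP[a1 a1X va1] /bigcupP[a2 a2X va2].
case: (eqVneq a1 a2) => [E|ne]; first by apply: (conn1 a1) => //; rewrite E.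
have [a1H a2H] : a1 \in hE H /\ a2 \in hE H.
  by move: a1X a2X; rewrite !inE => /andP[_ ->] /andP[_ ->].
have adj : edge_adj H a1 a2.
  by rewrite /edge_adj /= a1H a2H ne; apply/set0Pn; exists v; rewrite inE va1.
have [i iN /andP[i1 i2]] := dedge a1 a2 (in_setT _) (in_setT _) adj.
have iN' : i < N.+1 by [].
apply: connect_trans (_ : connect _ u1 (Ordinal iN')) _.
  by apply: (conn1 a1) => //; rewrite inE i1.
by apply: (conn1 a2) => //; rewrite inE i2.
Qed.

(** * Dilutions *)

Section Dilution.
Variables (T : finType) (H : hypergraph T).
Implicit Types (W D : {set T}) (ka : {set T} -> {set T}) (v : T).

Definition cls ka (c : {set T}) : {set T} := \bigcup_(a in [set a in hE H | ka a == c]) a.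

(* The hypergraph obtained from [H] when the edges have been merged along the
   fibres of [ka] and the vertices in [D] have been removed from all edges. *)
Definition quot W D ka : hypergraph T := Hyp W [set cls ka c :\: D | c in ka @: hE H].

Lemma clsP ka c y : reflect (exists a, [/\ a \in hE H, ka a = c & y \in a]) (y \in cls ka c).
Proof.
apply: (iffP bigcupP) => [[a]|[a [aH E ya]]].
  by rewrite inE => /andP[aH /eqP E] ya; exists a.
by exists a; rewrite // inE aH E eqxx.
Qed.

Lemma quot_id : quot (hV H) set0 id = H.
Proof.
have E : [set cls id c :\: set0 | c in id @: hE H] = hE H.
  rewrite imset_id -[RHS]imset_id; apply: eq_in_imset => a aH; rewrite setD0.
  by apply/setP=> y; apply/clsP/idP=> [[b [_ <-]]//|ya]; exists a.
by rewrite /quot E; case: (H).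
Qed.

Lemma quot_del W D ka v : v \in W -> dil_step (quot W D ka) (quot (W :\ v) (v |: D) ka).
Proof.
move=> vW; have -> : quot (W :\ v) (v |: D) ka = del_vertex (quot W D ka) v.
  rewrite /quot /del_vertex /=; congr Hyp; rewrite -(imset_comp (fun a => a :\ v)); apply: eq_imset => c /=.
  by apply/setP=> y; rewrite !inE negb_or andbA.
exact: DS_vertex.
Qed.

(** Every label seen at [v] becomes [ka a0], so the new class is the union of the merged edges. [v]
    joins [D] but stays in [W], since a merge takes it out of the edges only. Different labels may
    carry the same set; comparing sets of sets on both sides absorbs such coincidences. *)
Lemma quot_merge W D ka v a0 : v \in W -> v \notin D -> a0 \in inc H v ->
  dil_step (quot W D ka)
    (quot W (v |: D) (fun a => if ka a \in ka @: inc H v then ka a0 else ka a)).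
Proof.
move=> vW vD a0v; set Kv := ka @: inc H v; set ka' := fun a => _.
have a0H : a0 \in hE H by move: a0v; rewrite inE => /andP[].
have c0K : ka a0 \in Kv by apply: imset_f.
have vcls c : (v \in cls ka c) = (c \in Kv).
  apply/clsP/imsetP=> [[a [aH E va]]|[a]]; first by exists a; rewrite // inE aH.
  by rewrite inE => /andP[aH va] ->; exists a.
have cls_out c : c \notin Kv -> cls ka' c = cls ka c.
  move=> cK; apply/setP=> y; apply/clsP/clsP=> [] [a [aH E ya]]; exists a; split=> //.
    by move: E; rewrite /ka'; case: ifP => // _ E; rewrite -E c0K in cK.
  by rewrite /ka' E (negPf cK).
have cls_in y : (y \in cls ka' (ka a0)) <-> exists2 c, c \in Kv & y \in cls ka c.
  split=> [/clsP[a [aH E ya]]|[c cK /clsP[a [aH E ya]]]].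
    exists (ka a); last by apply/clsP; exists a.
    by move: E; rewrite /ka'; case: ifP => // aK E; rewrite E c0K in aK.
  by apply/clsP; exists a; split=> //; rewrite /ka' E cK.
have -> : quot W (v |: D) ka' = Defs.merge (quot W D ka) v; last exact: DS_merge.
rewrite /quot /Defs.merge /=; congr Hyp; apply/setP=> X; apply/imsetP/setUP.
  case=> _ /imsetP[a aH ->] ->; have [aK|aK] := boolP (ka a \in Kv).
    have -> : ka' a = ka a0 by rewrite /ka' aK.
    right; apply/set1P/setP=> y; rewrite !inE negb_or -andbA; case: (y != v) => //=.
    apply/andP/bigcupP=> [[yD /cls_in[c cK yc]]|[Z]].
      exists (cls ka c :\: D); last by rewrite inE yD.
      rewrite inE; apply/andP; split; last by rewrite inE vD vcls.
      by apply: imset_f; case/imsetP: cK => b; rewrite inE => /andP[bH _] ->; apply: imset_f.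
    rewrite inE => /andP[/imsetP[c _ ->]]; rewrite inE vcls => /andP[_ cK].
    by rewrite inE => /andP[yD yc]; split=> //; apply/cls_in; exists c.
  have -> : ka' a = ka a by rewrite /ka' (negPf aK).
  left; rewrite cls_out //; have E : cls ka (ka a) :\: (v |: D) = cls ka (ka a) :\: D.
    apply/setP=> y; rewrite !inE negb_or; case: (eqVneq y v) => //= ->.
    by rewrite vcls (negPf aK) andbF.
  rewrite E !inE vcls (negPf aK) andbF /= andbF /=; apply: imset_f; exact: imset_f.
case=> [/setDP[/imsetP[c cK ->]]|/set1P->].
  rewrite !inE vD vcls /= => h.
  have {h} cN : c \notin Kv.
    by apply: contra h => ->; rewrite andbT; apply: imset_f.
  case/imsetP: cK => a aH E; exists c.
    by apply/imsetP; exists a; rewrite // /ka' -E (negPf cN).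
  rewrite cls_out //; apply/setP=> y; rewrite !inE negb_or; case: (eqVneq y v) => //= ->.
  by rewrite vcls (negPf cN) andbF.
exists (ka a0); first by apply/imsetP; exists a0; rewrite // /ka' c0K.
apply/setP=> y; rewrite !inE negb_or -andbA; case: (y != v) => //=.
apply/bigcupP/andP=> [[Z]|[yD /cls_in[c cK yc]]].
  rewrite inE => /andP[/imsetP[c _ ->]]; rewrite inE vcls => /andP[_ cK].
  by rewrite inE => /andP[yD yc]; split=> //; apply/cls_in; exists c.
exists (cls ka c :\: D); last by rewrite inE yD.
rewrite inE; apply/andP; split; last by rewrite inE vD vcls.
by apply: imset_f; case/imsetP: cK => b; rewrite inE => /andP[bH _] ->; apply: imset_f.
Qed.

Variables (K : finType) (phi : K -> {set {set T}}) (V0 : {set T}).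
Hypothesis dphi : forall x y a, a \in phi x -> a \in phi y -> x = y.

(** The vertices to merge on. The middle clause leaves out vertices in no edge, where a merge would
    add the empty edge. *)
Definition inner v := [&& v \in hV H, inc H v != set0 & [exists x, inc H v \subset phi x]].

Hypothesis V0inner : forall v, v \in V0 -> ~~ inner v.

(** Vertices are treated one at a time: those of [V0] are kept, inner ones are merged on and then
    deleted, the others are deleted. The last conclusion is the invariant: labels are identified
    only within one branch set, because all classes at an inner vertex lie in the branch set that
    contains its edges. *)
Lemma dilute_to_quot : V0 \subset hV H -> exists ka,
  [/\ clos_refl_trans _ (@dil_step T) H (quot V0 (hV H :\: V0) ka),
      forall v a b, inner v -> a \in inc H v -> b \in inc H v -> ka a = ka b &
      forall a b, a \in hE H -> b \in hE H -> ka a = ka b ->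
        a = b \/ exists x, a \in phi x /\ b \in phi x].
Proof.
move=> sV0.
suff main (s : seq T) : {subset s <= hV H} -> exists ka,
  [/\ clos_refl_trans _ (@dil_step T) H (quot (hV H :\: ([set v in s] :\: V0)) ([set v in s] :\: V0) ka),
      forall v a b, v \in s -> inner v -> a \in inc H v -> b \in inc H v -> ka a = ka b &
      forall a b, a \in hE H -> b \in hE H -> ka a = ka b ->
        a = b \/ exists x, a \in phi x /\ b \in phi x].
  have [|ka [h1 h2 h3]] := main (enum (hV H)); first by move=> v; rewrite mem_enum.
  exists ka; split=> // [|v a b iv]; last first.
    by apply: (h2 v) => //; rewrite mem_enum; case/and3P: iv.
  have E : [set v in enum (hV H)] = hV H by apply/setP=> v; rewrite inE mem_enum.
  rewrite E in h1; rewrite (_ : hV H :\: (hV H :\: V0) = V0) // in h1.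
  by rewrite setDDr setDv set0U; apply/setIidPr.
elim: s => [|v s IH] sub.
  exists id; split=> // [|a b _ _ ->]; last by left.
  have -> : [set v in [::]] :\: V0 = set0 by apply/setP=> v; rewrite !inE andbF.
  by rewrite setD0 quot_id; apply: rt_refl.
have [ka [h1 h2 h3]] := IH (fun u us => sub u (mem_behead (s := v :: s) us)).
have vH : v \in hV H by apply: sub; rewrite mem_head.
set Z := [set u in s] :\: V0 in h1.
have [vs|vs] := boolP (v \in s).
  exists ka; split=> //.
    rewrite (_ : [set u in v :: s] = [set u in s]) //; apply/setP=> u; rewrite !inE.
    by case: eqP => // ->; rewrite vs.
  by move=> u a b; rewrite inE => /orP[/eqP->|]; apply: h2.
have [v0|v0] := boolP (v \in V0).
  exists ka; split=> //.
    rewrite (_ : [set u in v :: s] :\: V0 = Z) //; apply/setP=> u; rewrite !inE.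
    by case: eqP => // ->; rewrite v0 (negPf vs).
  by move=> u a b; rewrite inE => /orP[/eqP->|]; [rewrite (negPf (V0inner v0)) | apply: h2].
have vZ : v \notin Z by rewrite !inE (negPf vs) andbF.
have EZ : [set u in v :: s] :\: V0 = v |: Z.
  by apply/setP=> u; rewrite !inE; case: eqP => // ->; rewrite v0.
have EW : hV H :\: (v |: Z) = (hV H :\: Z) :\ v.
  by apply/setP=> u; rewrite !inE negb_or andbA.
have vW : v \in hV H :\: Z by rewrite inE vZ.
rewrite EZ EW; have [iv|iv] := boolP (inner v); last first.
  exists ka; split=> //.
    by apply: rt_trans h1 _; apply: rt_step; apply: quot_del.
  by move=> u a b; rewrite inE => /orP[/eqP->|]; [rewrite (negPf iv) | apply: h2].
have /and3P[_ /set0Pn[a0 a0v] /existsP[x /subsetP sx]] := iv.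
pose ka' a := if ka a \in ka @: inc H v then ka a0 else ka a.
have c0K : ka a0 \in ka @: inc H v by apply: imset_f.
have inx a : a \in hE H -> ka a \in ka @: inc H v -> a \in phi x.
  move=> aH /imsetP[b bv E]; have bx := sx _ bv.
  have bH : b \in hE H by move: bv; rewrite inE => /andP[].
  case: (h3 _ _ aH bH E) => [->//|[x' [ax' bx']]].
  by rewrite (dphi bx bx').
exists ka'; split.
- apply: rt_trans h1 _; apply: rt_trans (rt_step _ _ _ _ (quot_merge ka vW vZ a0v)) _.
  by have := @quot_del _ (v |: Z) ka' v vW; rewrite setUA setUid; apply: rt_step.
- move=> u a b; rewrite inE => /orP[/eqP->|us] iu au bu; rewrite /ka'.
    by rewrite !imset_f.
  by rewrite (h2 u a b us iu au bu).
- move=> a b aH bH; rewrite /ka'; case: ifP => aK; case: ifP => bK E.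
  + by right; exists x; rewrite !inx.
  + by rewrite -E c0K in bK.
  + by rewrite E c0K in aK.
  + exact: h3.
Qed.

End Dilution.

(** * The jigsaw from a grid minor *)

Lemma grid_edgeP n (g : {set 'I_n * 'I_n}) :
  reflect (exists x y, grid_adj x y /\ g = [set x; y]) (g \in hE (grid n)).
Proof.
apply: (iffP imset2P) => [[x y _]|[x [y [xy ->]]]].
  by rewrite inE => xy ->; exists x, y.
by exists x y; rewrite ?inE.
Qed.

Section GridMinor.
Variables (T : finType) (H : hypergraph T) (n : nat).
Hypothesis wfH : wf_hyp H.
Hypothesis degH : forall v, v \in hV H -> #|inc H v| <= 2.
Variable phi : 'I_n * 'I_n -> {set {set T}}.
Hypothesis cphi : forall x, conn (edge_adj H) (phi x).
Hypothesis dphi : forall x y a, a \in phi x -> a \in phi y -> x = y.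
Hypothesis aphi : forall x y, grid_adj x y -> adjacent (edge_adj H) (phi x) (phi y).
Hypothesis n2 : 2 <= n.

Let K := ('I_n * 'I_n)%type.

(** On the kept vertices this map becomes the isomorphism onto the jigsaw, whose vertices are the
    edges of the grid. *)
Definition ends (v : T) : {set K} := [set x | [exists a in phi x, v \in a]].

Lemma grid_nbr (x : K) : exists y, grid_adj x y.
Proof.
case: x => i j; have jn := ltn_ord j; case: (posnP j) => [j0|j0].
  by exists (i, Ordinal n2); rewrite /= j0 eqxx.
have lt : j.-1 < n by lia.
by exists (i, Ordinal lt); rewrite /= eqxx prednK // eqxx orbT.
Qed.

(** An isolated set that is not an edge also forms a connected branch set; a neighbour in the grid
    excludes this, which is where [2 <= n] enters. *)
Lemma phi_sub x : phi x \subset hE H.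
Proof.
have [y /aphi[a [b [ax _ ab]]]] := grid_nbr x.
by apply: conn_restr_sub (cphi x) ax _; case/and3P: ab.
Qed.

Lemma inc2 v a b : a \in inc H v -> b \in inc H v -> a != b -> inc H v = [set a; b].
Proof.
move=> av bv ab; apply/esym/eqP; rewrite eqEcard cards2 ab; apply/andP; split.
  by apply/subsetP=> c /set2P[->|->].
apply: degH; move: av; rewrite inE => /andP[/wfH/subsetP]; exact.
Qed.

(** Degree two enters here: a vertex shared by two edges lies in no third one, so merging on it
    fuses exactly these two. *)
Lemma edge_vertex a b : edge_adj H a b -> exists v, [/\ v \in hV H & inc H v = [set a; b]].
Proof.
case/and3P=> aH bH /andP[ab /set0Pn[v /setIP[va vb]]].
exists v; split; first exact: (subsetP (wfH aH)).
by apply: inc2; rewrite // inE ?aH ?bH.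
Qed.

Lemma ends_edge x y : grid_adj x y -> exists v, v \in hV H /\ ends v = [set x; y].
Proof.
move=> /aphi[a [b [ax bY ab]]]; have [v [vH Ev]] := edge_vertex ab.
have mem c : (c \in [set a; b]) -> c \in hE H /\ v \in c.
  by rewrite -Ev inE => /andP.
exists v; split=> //; apply/setP=> z; rewrite !inE; apply/existsP/orP.
  case=> c /andP[cz vc]; have : c \in inc H v by rewrite inE vc (subsetP (phi_sub z)).
  rewrite Ev => /set2P[E|E]; rewrite E in cz; [left|right]; apply/eqP.
    exact: dphi cz ax.
  exact: dphi cz bY.
case=> /eqP->; [exists a | exists b]; rewrite ?ax ?bY /=.
  by have [] := mem a (set21 _ _).
by have [] := mem b (set22 _ _).
Qed.

(** One vertex [w g] is kept for each grid edge [g]. Its two edges lie in different branch sets, so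
    it is not inner. Adjacent edges of one branch set share an inner vertex, hence each branch set
    is fused into a single class, whose trace [Ex x] on [V0] corresponds to the grid edges at
    [x]. *)
Lemma grid_minor_dilutes : dilutes H (jigsaw n).
Proof.
have wex (g : {set K}) : exists v : T, g \in hE (grid n) -> v \in hV H /\ ends v = g.
  have [y0 /ends_edge[v0 _]] := grid_nbr (Ordinal n2, Ordinal n2).
  case: (boolP (g \in hE (grid n))) => [/grid_edgeP[x [y [xy ->]]]|_]; last by exists v0.
  by have [v hv] := ends_edge xy; exists v.
have [w wP] := fin_all_exists wex.
pose V0 := w @: hE (grid n).
have V0E v : v \in V0 -> [/\ v \in hV H, ends v \in hE (grid n) & w (ends v) = v].
  by case/imsetP=> g gE ->; have [h1 h2] := wP g gE; rewrite h2.
have sV0 : V0 \subset hV H by apply/subsetP=> v /V0E[].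
have inends v a x : a \in phi x -> v \in a -> x \in ends v.
  by move=> ax va; rewrite inE; apply/existsP; exists a; rewrite ax.
have endsP v x : x \in ends v -> exists2 a, a \in phi x & v \in a.
  by rewrite inE => /existsP[a /andP[]]; exists a.
have V0inc v : v \in V0 -> exists x y a b, [/\ a \in phi x, b \in phi y, x != y &
    inc H v = [set a; b]].
  case/V0E=> vH /grid_edgeP[x [y [xy E]]] _.
  have [a ax va] : exists2 a, a \in phi x & v \in a by apply: endsP; rewrite E set21.
  have [b bY vb] : exists2 b, b \in phi y & v \in b by apply: endsP; rewrite E set22.
  have ne := grid_adj_neq xy.
  have aH := subsetP (phi_sub x) _ ax; have bH := subsetP (phi_sub y) _ bY.
  exists x, y, a, b; split=> //; apply: inc2; rewrite ?inE ?aH ?bH //.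
  by apply: contraNneq ne => ab; rewrite ab in ax; rewrite (dphi ax bY).
have V0inner v : v \in V0 -> ~~ inner H phi v.
  case/V0inc=> x [y [a [b [ax bY ne Ei]]]]; apply/negP=> /and3P[_ _ /existsP[z /subsetP sz]].
  have az : a \in phi z by apply: sz; rewrite Ei set21.
  have bz : b \in phi z by apply: sz; rewrite Ei set22.
  by move: ne; rewrite (dphi ax az) (dphi bY bz) eqxx.
have [ka [reach kain kaout]] := dilute_to_quot dphi V0inner sV0.
pose Ex (x : K) : {set T} := (\bigcup_(a in phi x) a) :&: V0.
have sub0 (X : {set T}) : X \subset hV H -> X :\: (hV H :\: V0) = X :&: V0.
  by rewrite -setD_eq0 => /eqP XH; rewrite setDDr XH set0U.
have kaphi x a b : a \in phi x -> b \in phi x -> ka a = ka b.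
  move=> ax bx; have [_ /(_ _ _ ax bx)/connectP[p]] := cphi x.
  elim: p a ax => [|c p IH] a ax /=; first by move=> _ ->.
  case/andP=> /and3P[_ cx ac] pp lst; rewrite -(IH c cx pp lst).
  have [v [vH Ev]] := edge_vertex ac.
  apply: (kain v); rewrite ?Ev ?set21 ?set22 //; apply/and3P; split=> //.
    by apply/set0Pn; exists a; rewrite Ev set21.
  by apply/existsP; exists x; rewrite Ev; apply/subsetP=> d /set2P[->|->].
have cls_phi x a : a \in phi x -> cls H ka (ka a) = \bigcup_(b in phi x) b.
  move=> ax; have aH := subsetP (phi_sub x) _ ax.
  apply/setP=> y; apply/clsP/bigcupP=> [[b [bH E yb]]|[b bx yb]]; last first.
    by exists b; split=> //; [apply: (subsetP (phi_sub x)) | apply: kaphi bx ax].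
  exists b => //; case: (kaout b a bH aH E) => [->//|[x' [bx' ax']]].
  by rewrite (dphi ax ax').
have cls_sub c : cls H ka c \subset hV H.
  by apply/subsetP=> y /clsP[a [aH _ ya]]; apply: (subsetP (wfH aH)).
have bigE x : (\bigcup_(b in phi x) b) \subset hV H.
  by apply/bigcupsP=> b bx; apply: wfH; apply: (subsetP (phi_sub x)).
pose Hf := quot H V0 (hV H :\: V0) ka.
have ExHf x : Ex x \in hE Hf.
  have [[a ax] _] := cphi x; apply/imsetP; exists (ka a).
    by apply: imset_f; apply: (subsetP (phi_sub x)).
  by rewrite (cls_phi x a ax) sub0.
have HfEx (X : {set T}) : X \in hE Hf -> X != set0 -> exists x, X = Ex x.
  case/imsetP=> c /imsetP[a aH ->] ->; rewrite sub0 // => /set0Pn[v /setIP[/clsP[b [bH E vb]] vV]].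
  have [x [y [a1 [a2 [a1x a2y _ Ei]]]]] := V0inc v vV.
  have : b \in inc H v by rewrite inE bH.
  by rewrite Ei -E => /set2P[]->; [exists x; rewrite (cls_phi x) | exists y; rewrite (cls_phi y)].
have inEx v x : v \in V0 -> (v \in Ex x) = (x \in ends v).
  move=> vV; rewrite inE vV andbT; apply/bigcupP/idP=> [[a ax va]|/endsP[a]]; last by exists a.
  exact: inends ax va.
have Ex0 x : Ex x != set0.
  have [y xy] := grid_nbr x; have gE : [set x; y] \in hE (grid n) by apply/grid_edgeP; exists x, y.
  apply/set0Pn; exists (w [set x; y]); rewrite inEx; first by have [_ ->] := wP _ gE; rewrite set21.
  exact: imset_f.
have EHf : hE Hf :\ set0 = [set Ex x | x : K].
  apply/setP=> X; apply/setD1P/imsetP=> [[X0 /HfEx[//|x ->]]|[x _ ->]]; first by exists x.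
  by split.
exists (Hyp V0 [set Ex x | x : K]); split.
  apply: rt_trans reach _; rewrite -EHf -/Hf.
  (* Edges outside all branch sets contain no kept vertex and shrink to the empty edge, which is
     deleted as a proper subset of some [Ex x]. *)
  have [h0|h0] := boolP (set0 \in hE Hf).
    apply: rt_step; apply: (@DS_edge _ Hf set0 (Ex (Ordinal n2, Ordinal n2))) => //.
    by rewrite proper0.
  have -> : hE Hf :\ set0 = hE Hf.
    by apply/setP=> X; rewrite in_setD1; case: eqP => // ->; rewrite (negPf h0).
  exact: rt_refl.
exists ends; split=> /=.
- by move=> u v /V0E[_ _ Eu] /V0E[_ _ Ev] E; rewrite -Eu E Ev.
- apply/setP=> g; apply/imsetP/idP=> [[v /V0E[_ gE _] -> //]|gE].
  by exists (w g); [apply: imset_f | have [_ ->] := wP g gE].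
have im x : ends @: Ex x = inc (grid n) x.
  apply/setP=> g; rewrite inE; apply/imsetP/andP=> [[v vE ->]|[gE xg]].
    have vV : v \in V0 by move: vE; rewrite inE => /andP[].
    by rewrite -inEx //; have [_ h _] := V0E v vV.
  have [wH wE] := wP g gE; exists (w g); rewrite ?wE // inEx ?wE //.
  exact: imset_f.
apply/setP=> G; apply/imsetP/imsetP=> [[_ /imsetP[x _ ->] ->]|[x _ ->]].
  by exists x; rewrite ?inE ?im.
by exists (Ex x); [apply: imset_f | rewrite im].
Qed.

End GridMinor.

(** The grid with one vertex has no edge, so its dual has no vertex and a single, empty edge. With
    an empty branch set no vertex is inner, all are deleted, and the edges collapse to the empty
    one. *)
Lemma dilutes_jigsaw1 (T : finType) (H : hypergraph T) :
  wf_hyp H -> hE H != set0 -> dilutes H (jigsaw 1).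
Proof.
move=> wfH /set0Pn[a aH].
pose phi (x : unit) : {set {set T}} := set0.
have dphi x y b : b \in phi x -> b \in phi y -> x = y by rewrite inE.
have V0i v : v \in (set0 : {set T}) -> ~~ inner H phi v by rewrite inE.
have [ka [reach _ _]] := dilute_to_quot dphi V0i (sub0set _).
eexists; split; first exact: reach.
have E0 : hE (quot H set0 (hV H :\: set0) ka) = [set set0].
  apply/setP=> X; rewrite inE; apply/imsetP/eqP=> [[c _ ->]|->].
    apply/setP=> y; rewrite setD0 !inE; apply/andP=> [[yH /clsP[b [bH _ yb]]]].
    by rewrite (subsetP (wfH b bH)) in yH.
  exists (ka a); first exact: imset_f.
  apply/setP=> y; rewrite setD0 !inE; apply/esym/andP=> [[yH /clsP[b [bH _ yb]]]].
  by rewrite (subsetP (wfH b bH)) in yH.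
have G0 : hE (grid 1) = set0.
  apply/setP=> g; rewrite inE; apply/negP=> /grid_edgeP[x [y [/grid_adj_neq]]].
  by case: x y => i j [i' j']; rewrite (ord1 i) (ord1 j) (ord1 i') (ord1 j') eqxx.
exists (fun=> set0); split; first by move=> u v; rewrite inE.
  by rewrite imset0 -G0.
rewrite E0 imset_set1 imset0; apply/setP=> X; rewrite inE; apply/eqP/imsetP=> [->|[x _ ->]].
  exists (ord0, ord0); rewrite ?inE //; apply/setP=> g; rewrite !inE G0 inE //.
by apply/setP=> g; rewrite !inE G0 inE.
Qed.

Theorem theorem4p6 :
  exists f : nat -> nat,
    forall n : nat, 1 <= n ->
    forall (T : finType) (H : hypergraph T),
      wf_hyp H -> degree H = 2 -> ~ ghw_le H (f n) ->
      dilutes H (jigsaw n).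
Proof.
(* [excluded_grid] only asserts that a width exists for each [n]; classical description makes it a
   function. *)
pose f n := constructive_indefinite_description _ (excluded_grid n).
exists (fun n => sval (f n)) => n n1 T H wfH degH nghw.
have [[phi [c1 c2 c3]]|[N [par [bag /rooted_dec_ghw]]]] := svalP (f n) _ _ (edge_adj_sym H); last by [].
have degle v : v \in hV H -> #|inc H v| <= 2 by rewrite -degH => vH; apply: leq_bigmax_cond.
have [n2|n2] := leqP 2 n.
  apply: (@grid_minor_dilutes T H n wfH degle phi) => // x y a ax ay.
  apply/eqP; apply: contraT => /c2 dxy; by rewrite (disjointFr dxy ax) in ay.
have -> : n = 1 by lia.
apply: dilutes_jigsaw1 => //; apply/eqP=> E0.
have : degree H = 0; last by rewrite degH.
by apply: big1 => v _; apply: eq_card0 => a; rewrite !inE E0 inE.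
Qed.
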